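(* Let $d>2/\sqrt3$, and consider the $P_1$ (continuous piecewise linear) finite-element discretization on the triangular mesh of the hexagon with nodes $\boldsymbol{x}_1,\dots,\boldsymbol{x}_{13}$ described in the context (the unperturbed mesh), with stiffness matrix $A=(a_{i,j})$ and mass matrix $M=(m_{i,j})$. Let $$\lambda_*=\frac{a_{2,2}-2a_{2,3}}{m_{2,2}-2m_{2,3}}$$ and suppose that $\lambda_*$ is a simple Neumann eigenvalue for the unperturbed mesh, i.e. $\dim\ker(A-\lambda_*M)=1$. Let the mesh be deformed by moving each node along a $C^1$ path $\boldsymbol{x}_i(s)$, defined for $s$ near $0$ with $\boldsymbol{x}_i(0)=\boldsymbol{x}_i$, keeping the connectivity of the triangulation fixed; let $A(s),M(s)$ be the resulting $C^1$ families of symmetric stiffness and mass matrices (for $|s|$ small), and let $\dot A,\dot M$ denote their derivatives at $s=0$. Define $$u_I=(0,1,-1,1,-1,1,-1)\in\mathbb{R}^7,\qquad \hat u_B=(1,-1,1,-1,1,-1)\in\mathbb{R}^6.$$ If $$\big\langle(\dot A_{BI}-\lambda_*\dot M_{BI})u_I,\hat u_B\big\rangle\ne0,$$ then the deformed mesh satisfies the unique continuation principle for $0<|s|\ll1$; that is, there is $\varepsilon>0$ such that for every $s$ with $0<|s|<\varepsilon$ the $P_1$ discretization on the deformed mesh satisfies the unique continuation principle.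
   Context: The unperturbed mesh (depending on the parameter $d>2/\sqrt3$, a condition which ensures that the triangulation is valid): node $1$ is at $(0,0)$; nodes $2,\dots,7$ form the inner ring, node $j+2$ being at $(\cos\frac{j\pi}{3},\sin\frac{j\pi}{3})$ for $0\le j\le5$; nodes $8,\dots,13$ form the outer ring, node $8+k$ being at $(d\cos\frac{(2k-1)\pi}{6},d\sin\frac{(2k-1)\pi}{6})$ for $0\le k\le5$ (so node $8$ lies between nodes $7$ and $2$ in angle, node $9$ between nodes $2$ and $3$, and so on cyclically). The domain is the regular hexagon with corners at nodes $8,\dots,13$, and it is divided into 18 triangles: six with vertices the origin and two consecutive inner-ring nodes; six with vertices two consecutive inner-ring nodes and the outer-ring node lying between them in angle; and six with vertices two consecutive outer-ring nodes and the inner-ring node lying between them in angle. The interior nodes are $1,\dots,7$ and the boundary nodes are $8,\dots,13$. The denominator $m_{2,2}-2m_{2,3}$ is positive for every $d>2/\sqrt3$, so $\lambda_*$ is well defined. The deformed mesh at parameter $s$ has the same 18 triangles in terms of node labels, with node positions $\boldsymbol{x}_i(s)$; its domain is the union of these triangles. For a triangular mesh of a domain $\Omega$ with nodes $\boldsymbol{x}_i$, $\phi_i$ is the continuous function on $\overline\Omega$ that is affine on each triangle with $\phi_i(\boldsymbol{x}_j)=\delta_{i,j}$; the stiffness and mass matrices are $a_{i,j}=\int_\Omega\nabla\phi_j\cdot\nabla\phi_i\,dA$ and $m_{i,j}=\int_\Omega\phi_j\phi_i\,dA$. With respect to the partition into interior nodes ($I$) and boundary nodes ($B$), write $$A=\begin{pmatrix}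 A_{II} & A_{IB} \\ A_{BI} & A_{BB} \end{pmatrix},\qquad M=\begin{pmatrix} M_{II} & M_{IB} \\ M_{BI} & M_{BB} \end{pmatrix},$$ and similarly for $\dot A,\dot M$. A Neumann eigenvalue is a number $\lambda$ for which $Au=\lambda Mu$ has a nonzero solution $u$. Put $\mathcal{S}_{\rm in}(\lambda)=\ker(A_{II}-\lambda M_{II})\cap\ker(A_{BI}-\lambda M_{BI})$. The discretization satisfies the unique continuation principle if $\mathcal{S}_{\rm in}(\lambda)=\{0\}$ for all $\lambda\in\mathbb{R}$. $\langle\cdot,\cdot\rangle$ is the Euclidean inner product. *)

(* Defs.v *)
From HB Require Import structures.
From mathcomp Require Import all_boot all_order all_algebra.
From mathcomp Require Import all_classical all_reals all_analysis.

Set Implicit Arguments.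
Unset Strict Implicit.
Unset Printing Implicit Defensive.

Import Order.TTheory GRing.Theory Num.Theory.
Import numFieldNormedType.Exports.

Local Open Scope classical_set_scope.
Local Open Scope ring_scope.

(* The nodes 1, ..., 13 are the ordinals 0, ..., 12. The first block of
   'I_(7 + 6) holds the interior nodes and the second one the boundary nodes,
   so that ulsubmx and dlsubmx give the blocks II and BI. *)
Definition node := 'I_(7 + 6).

Definition cyc6 (k : nat) : 'I_6 := Ordinal (ltn_pmod k (isT : (0 < 6)%N)).
Definition center : node := lshift 6 ord0.
Definition inner (k : nat) : node := lshift 6 (lift ord0 (cyc6 k)).
Definition outer (k : nat) : node := rshift 7 (cyc6 k).

(* outer k lies, in angle, between inner (k - 1) and inner k *)
Definition triangulation : seq (node * node * node) :=
  [seq (center, inner j, inner j.+1) | j <- iota 0 6] ++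
  [seq (inner j, outer j.+1, inner j.+1) | j <- iota 0 6] ++
  [seq (outer k, outer k.+1, inner k) | k <- iota 0 6].

Section FiniteElements.
Variable R : realType.

Implicit Types (x : node -> R * R) (A M : 'M[R]_(7 + 6)).

Definition hexagon (d : R) (i : node) : R * R :=
  match fintype.split i with
  | inl i' => if unlift ord0 i' is Some j
              then (cos (j%:R * pi / 3), sin (j%:R * pi / 3))
              else (0, 0)
  | inr k => (d * cos ((2 * k%:R - 1) * pi / 6),
              d * sin ((2 * k%:R - 1) * pi / 6))
  end.

Definition triangle x (t : node * node * node) : set (R * R) :=
  let: (i, j, k) := t in
  [set p | exists a b c : R,
     [/\ 0 <= a, 0 <= b, 0 <= c, a + b + c = 1
       & p = a *: x i + b *: x j + c *: x k]].

Definition domain x : set (R * R) :=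
  \bigcup_(t in [set` triangulation]) triangle x t.

(* The domain minus the edges (a null set), where the gradients of piecewise
   affine functions are defined. *)
Definition domain_off_edges x : set (R * R) :=
  \bigcup_(t in [set` triangulation]) (triangle x t)°.

Definition is_nodal_basis_function x (i : node) (f : R * R -> R) : Prop :=
  [/\ {within domain x, continuous f},
      forall t, t \in triangulation -> exists a b c : R,
        forall p, triangle x t p -> f p = a * p.1 + b * p.2 + c
    & forall j, f (x j) = (i == j)%:R].

(* Unique on domain x when it exists; its values elsewhere are irrelevant. *)
Definition phi x (i : node) : R * R -> R :=
  xget (fun=> 0) [set f | is_nodal_basis_function x i f].

Definition dotgrad (f g : R * R -> R) (p : R * R) : R :=
  'D_((1 : R), (0 : R)) f p * 'D_((1 : R), (0 : R)) g p +
  'D_((0 : R), (1 : R)) f p * 'D_((0 : R), (1 : R)) g p.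

Local Notation area := (@lebesgue_measure R \x @lebesgue_measure R)%E.

Definition stiffness x : 'M[R]_(7 + 6) :=
  \matrix_(i, j) \int[area]_(p in domain_off_edges x)
    dotgrad (phi x j) (phi x i) p.

Definition mass x : 'M[R]_(7 + 6) :=
  \matrix_(i, j) \int[area]_(p in domain x) (phi x j p * phi x i p).

(* cokermx B has the space of column vectors {u | B *m u = 0} as its column
   space, whereas kermx is about row vectors. *)
Definition simple_neumann_eigenvalue A M (l : R) : Prop :=
  \rank (cokermx (A - l *: M)) = 1%N.

Definition S_in A M (l : R) : set 'cV[R]_7 :=
  [set u | (ulsubmx A - l *: ulsubmx M) *m u = 0] `&`
  [set u | (dlsubmx A - l *: dlsubmx M) *m u = 0].

Definition unique_continuation A M : Prop :=
  forall l : R, S_in A M l = [set 0].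

Definition lambda_star (d : R) : R :=
  let A := stiffness (hexagon d) in let M := mass (hexagon d) in
  (A (inner 0) (inner 0) - 2 * A (inner 0) (inner 1)) /
  (M (inner 0) (inner 0) - 2 * M (inner 0) (inner 1)).

Definition mxderiv m n (F : R -> 'M[R]_(m, n)) (s : R) : 'M[R]_(m, n) :=
  \matrix_(i, j) derive1 (fun r => F r i j) s.

Definition C1_near (V : normedModType R) (f : R -> V) (a : R) : Prop :=
  \forall s \near a, derivable f s 1 /\ {for s, continuous (derive1 f)}.

Definition u_I : 'cV[R]_7 :=
  \col_i (if unlift ord0 i is Some j then (-1) ^+ j else 0).

Definition u_B : 'cV[R]_6 := \col_k (-1) ^+ k.

Definition inner_product n (v w : 'cV[R]_n) : R := \sum_k v k 0 * w k 0.

End FiniteElements.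

(* Main.v *)
(* The vector u_B is orthogonal to the columns of A_BI and M_BI of the regular
   mesh: each inner node has two outer neighbours, with equal entries and
   opposite signs in u_B. Hence, if u lies in S_in(l) for the mesh at s <> 0,
   then u_B^T (A_BI(s) - A_BI(0)) u = l u_B^T (M_BI(s) - M_BI(0)) u, which can
   be divided by s. Adding this equation to (A_II - l M_II) u = 0 and
   (A_BI - l M_BI) u = 0 gives an overdetermined pencil which has a limit at
   s = 0. By the symmetries of the regular mesh the first two blocks of the
   limit pencil have a kernel only at l = lambda_*, where it is spanned by u_I,
   and there the additional row does not vanish by transversality. The limit
   pencil is thus injective for all l (including l = oo), and injectivity is
   an open condition by compactness of the set of unit vectors u and of the
   projective line of l. The integrals enter through an affine change of
   variables to the reference simplex only, so that their values need not be
   computed, except for the inequalities 0 < int u v < int u^2. *)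
Require Import Defs.
From HB Require Import structures.
From mathcomp Require Import all_boot all_order all_algebra.
From mathcomp Require Import all_classical all_reals all_analysis.
From mathcomp Require Import measurable_realfun ring lra.
Set Implicit Arguments.
Unset Strict Implicit.
Unset Printing Implicit Defensive.

Import Order.TTheory GRing.Theory Num.Theory.
Import numFieldNormedType.Exports.

Local Open Scope classical_set_scope.
Local Open Scope ring_scope.

(** * Affine changes of variables in the plane *)

(** The matrix entries are integrals of functions picked by choice on a union of triangles, so
    nothing can be said about them before the triangles are known to fit together. This is needed at
    [s <> 0] too, where the mesh has no symmetry. Validity of a mesh is therefore reduced to
    finitely many strict inequalities, which survive small displacements of the nodes. For the
    regular mesh they become polynomial inequalities in [e = sqrt 3 * d - 2 > 0] whose integer
    coefficients are nonnegative and not all zero, so one computation settles every [d]. On a valid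
    mesh each entry is a sum over triangles of rational functions of the node coordinates, whence
    the derivatives at [0]. Symmetry alone does not make a kernel vector alternate: the outer rows
    only say that [mu * b - nu * c] times the sum of two neighbouring inner values vanishes. That
    factor is nonzero because an outer node is coupled to its inner neighbours negatively by the
    stiffness and positively by the mass, while the two quadratic forms are nonnegative and positive
    definite. *)

Section AffineChangeOfVariables.
Variable R : realType.
Local Notation leb := (@lebesgue_measure R).
Local Notation area := (@lebesgue_measure R \x @lebesgue_measure R)%E.
Local Notation RR := (measurableTypeR R).

Lemma measurable_affine (a b : R) :
  measurable_fun [set: RR] (fun y : RR => a * y + b : RR).
Proof. by apply: measurable_funD => //; apply: measurable_funM. Qed.

(** A negative slope turns a left-open interval into a right-open one, so the preimage is only
    claimed to be some interval. *)
Lemma affine_preimage_itvoc (a b x y : R) : a != 0 -> exists i : interval R,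
  (fun z : R => a * z + b) @^-1` `]x, y]%classic = [set` i] /\
  (`|a|%:E * leb [set` i] = leb `]x, y]%classic)%E.
Proof.
move=> a0; have [ap|an|/eqP] := ltrgtP 0 a; last by rewrite eq_sym (negbTE a0).
- exists `](x - b) / a, (y - b) / a]; split.
    apply/seteqP; split=> z /=; rewrite !in_itv/= ltr_pdivrMr//
      ler_pdivlMr// (mulrC a) ltrBlDr lerBrDr//.
  rewrite !lebesgue_measure_itv/= !lte_fin ltr_pM2r ?invr_gt0// ltrD2r.
  case: ifP => _; last by rewrite mule0.
  by rewrite -!EFinD -EFinM gtr0_norm//; congr _%:E; field.
- exists `[(y - b) / a, (x - b) / a[; split.
    by apply/seteqP; split=> z /=; rewrite !in_itv/= ltr_ndivlMr//
      ler_ndivrMr// (mulrC a) ltrBlDr lerBrDr// andbC.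
  rewrite !lebesgue_measure_itv/= !lte_fin ltr_nM2r ?invr_lt0// ltrD2r.
  case: ifP => _; last by rewrite mule0.
  by rewrite -!EFinD -EFinM ltr0_norm//; congr _%:E; field.
Qed.

(** The pushforward scaled by [|a|] is a measure that has the right value on half-open intervals, so
    it is Lebesgue measure by uniqueness. *)
Lemma lebesgue_measure_affine (a b : R) (A : set RR) : a != 0 -> measurable A ->
  (`|a|%:E * leb ((fun y : RR => a * y + b)%R @^-1` A) = leb A)%E.
Proof.
move=> a0 mA.
have mf := measurable_affine a b.
pose nu0 : {measure set RR -> \bar R} := mscale (NngNum (normr_ge0 a))
    (pushforward leb (fun y : RR => a * y + b : RR)).
pose nu : {measure set RR -> \bar R} := nu0 mf.
suff -> : leb A = nu A by rewrite /nu /mscale/=.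
apply: lebesgue_measure_unique => //= _ [[x y]] _ <-.
rewrite /nu /mscale/= /pushforward/=.
by have [i [-> ->]] := @affine_preimage_itvoc a b x y a0.
Qed.

Lemma integral_affine (a b : R) (h : RR -> \bar R) : a != 0 ->
  measurable_fun setT h -> (forall y, 0 <= h y)%E ->
  (\int[leb]_y h y = `|a|%:E * \int[leb]_y h (a * y + b)%R)%E.
Proof.
move=> a0 mh h0.
have mf := measurable_affine a b.
pose nu0 : {measure set RR -> \bar R} := mscale (NngNum (normr_ge0 a))
    (pushforward leb (fun y : RR => a * y + b : RR)).
pose nu : {measure set RR -> \bar R} := nu0 mf.
rewrite (@eq_measure_integral _ _ _ _ nu); last first.
  by move=> A mA _; rewrite /nu /mscale/= -(@lebesgue_measure_affine a b).
rewrite ge0_integral_mscale//=; congr (_ * _)%E.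
by rewrite ge0_integral_pushforward.
Qed.

Lemma integral_swap (G : RR * RR -> \bar R) :
  measurable_fun setT G -> (forall p, 0 <= G p)%E ->
  (\int[area]_p G p = \int[area]_p G (p.2, p.1))%E.
Proof.
move=> mG G0.
rewrite fubini_tonelli1// (fubini_tonelli2 (fun p : RR * RR => G (p.2, p.1)))//.
apply: measurableT_comp => //; exact: measurable_fun_pair.
Qed.

Lemma measurable_affine2 (c a b : R) :
  measurable_fun [set: RR * RR] (fun q : RR * RR => c + a * q.1 + b * q.2 : RR).
Proof.
by apply: measurable_funD; [apply: measurable_funD => //|]; apply: measurable_funM.
Qed.

Lemma measurable_affine_map (c1 c2 a b a' b' : R) :
  measurable_fun [set: RR * RR] (fun q : RR * RR =>
    (c1 + a * q.1 + b * q.2, c2 + a' * q.1 + b' * q.2) : RR * RR).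
Proof. by apply: measurable_fun_pair; exact: measurable_affine2. Qed.

(* The map is factored into two one-variable affine substitutions. *)
Lemma integral_affine2_neq0 (c1 c2 a b a' b' : R) (G : RR * RR -> \bar R) :
  a != 0 -> a * b' - a' * b != 0 ->
  measurable_fun setT G -> (forall p, 0 <= G p)%E ->
  (\int[area]_p G p = `|a * b' - a' * b|%:E *
    \int[area]_q G (c1 + a * q.1 + b * q.2, c2 + a' * q.1 + b' * q.2)%R)%E.
Proof.
move=> a0 D0 mG G0; set D := a * b' - a' * b.
have Da0 : D / a != 0 by rewrite mulf_neq0// invr_eq0.
rewrite fubini_tonelli1//= /fubini_F.
(* Elimination of the first parameter: for a fixed first coordinate the second one is affine in the
   second parameter, with slope [D / a]. The later substitution in the first coordinate has slope
   [a], and the two slopes multiply to [D]. *)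
pose H (q : RR * RR) := G (q.1, (D / a) * q.2 + (c2 + a' / a * (q.1 - c1))).
have mH : measurable_fun setT H.
  apply: measurableT_comp => //; apply: measurable_fun_pair => //.
  apply: measurable_funD; first exact: measurable_funM.
  apply: measurable_funD => //; apply: measurable_funM => //.
  exact: measurable_funB.
under eq_integral => x _.
  rewrite (@integral_affine (D / a) (c2 + a' / a * (x - c1)))//; last first.
    by apply: measurableT_comp => //; exact: measurable_fun_pair.
  over.
rewrite ge0_integralZl//=; last first.
- by move=> x _; exact: integral_ge0.
- exact: (measurable_fun_fubini_tonelli_F H mH (fun=> G0 _)).
rewrite [X in (_ * X)%E](_ : _ = \int[leb]_v \int[leb]_u H (u, v))%E;
  last exact: (fubini_tonelli H mH (fun=> G0 _)).
under eq_integral => v _.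
  rewrite (@integral_affine a (c1 + b * v))//; last first.
  - by move=> u; exact: G0.
  - by apply: (measurableT_comp mH); exact: measurable_fun_pair.
  over.
pose K (q : RR * RR) := G (c1 + a * q.1 + b * q.2, c2 + a' * q.1 + b' * q.2).
have mK : measurable_fun setT K.
  by apply: measurableT_comp => //; exact: measurable_affine_map.
have HK v u : H (a * u + (c1 + b * v), v) = K (u, v).
  rewrite /H /K/=; congr (G (_, _)); first by ring.
  by rewrite /D; field.
under eq_integral => v _ do under eq_integral => u _ do rewrite HK.
rewrite ge0_integralZl//=; last first.
- by move=> v _; apply: integral_ge0 => u _; exact: G0.
- exact: (measurable_fun_fubini_tonelli_G K mK (fun=> G0 _)).
rewrite muleA -EFinM -normrM mulfVK//; congr (_ * _)%E.
by rewrite -[RHS]/(\int[area]_q K q)%E (fubini_tonelli2 K mK (fun=> G0 _)).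
Qed.

(** If [a = 0], the determinant forces [b != 0]; exchanging the two parameters reduces to the
    previous case and only changes the sign of the determinant. *)
Lemma integral_affine2 (c1 c2 a b a' b' : R) (G : RR * RR -> \bar R) :
  a * b' - a' * b != 0 ->
  measurable_fun setT G -> (forall p, 0 <= G p)%E ->
  (\int[area]_p G p = `|a * b' - a' * b|%:E *
    \int[area]_q G (c1 + a * q.1 + b * q.2, c2 + a' * q.1 + b' * q.2)%R)%E.
Proof.
move=> D0 mG G0; have [a0|a0] := eqVneq a 0; last exact: integral_affine2_neq0.
have b0 : b != 0 by apply: contraNneq D0 => ->; rewrite a0 mul0r mulr0 subrr.
rewrite (@integral_affine2_neq0 c1 c2 b a b' a')//; last first.
  by rewrite -opprB oppr_eq0 mulrC (mulrC b).
rewrite -normrN opprB (mulrC a') (mulrC a); congr (_ * _)%E.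
rewrite (@integral_swap (fun q =>
  G (c1 + b * q.1 + a * q.2, c2 + b' * q.1 + a' * q.2)))//=; last first.
  by apply: measurableT_comp => //; exact: measurable_affine_map.
by apply: eq_integral => q _; rewrite (addrAC c1) (addrAC c2).
Qed.

End AffineChangeOfVariables.

(** * Barycentric coordinates and integrals over a triangle *)

Section Triangles.
Variable R : realType.
Local Notation area := (@lebesgue_measure R \x @lebesgue_measure R)%E.
Local Notation RR := (measurableTypeR R).
Implicit Types a b c p : R * R.

(** Twice the signed area, positive for counterclockwise vertices; it is also the Jacobian of the
    affine map from the reference simplex. *)
Definition area2 a b c : R :=
  (b.1 - a.1) * (c.2 - a.2) - (b.2 - a.2) * (c.1 - a.1).

(** The barycentric coordinate belonging to the vertex [a]; cycling the arguments gives the other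
    two. *)
Definition bary a b c p : R := area2 p b c / area2 a b c.

Definition simplex : set (RR * RR) :=
  [set q | [/\ 0 < q.1, 0 < q.2 & q.1 + q.2 < 1]].

Definition open_triangle a b c : set (RR * RR) :=
  [set p | [/\ 0 < bary a b c p, 0 < bary b c a p & 0 < bary c a b p]].

Lemma area2_cycle a b c : area2 b c a = area2 a b c.
Proof. by rewrite /area2; ring. Qed.

Lemma area2_cycle2 a b c : area2 c a b = area2 a b c.
Proof. by rewrite /area2; ring. Qed.

Lemma bary_sum a b c p : area2 a b c != 0 ->
  bary a b c p + bary b c a p + bary c a b p = 1.
Proof.
move=> D0; rewrite /bary (area2_cycle a b c) (area2_cycle2 a b c) -2!mulrDl.
rewrite (_ : _ + _ = area2 a b c) ?divff// /area2.
by ring.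
Qed.

Lemma bary_affine_fst a b c (r s : R) : area2 a b c != 0 ->
  bary b c a (a.1 + (b.1 - a.1) * r + (c.1 - a.1) * s,
              a.2 + (b.2 - a.2) * r + (c.2 - a.2) * s) = r.
Proof.
move=> D0; rewrite /bary (area2_cycle a b c); apply: (mulIf D0).
by rewrite divfK// /area2/=; ring.
Qed.

Lemma bary_affine_snd a b c (r s : R) : area2 a b c != 0 ->
  bary c a b (a.1 + (b.1 - a.1) * r + (c.1 - a.1) * s,
              a.2 + (b.2 - a.2) * r + (c.2 - a.2) * s) = s.
Proof.
move=> D0; rewrite /bary (area2_cycle2 a b c); apply: (mulIf D0).
by rewrite divfK// /area2/=; ring.
Qed.

Lemma baryE a b c p : bary a b c p =
  (b.1 * c.2 - b.2 * c.1) / area2 a b c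
  + ((b.2 - c.2) / area2 a b c) * p.1 + ((c.1 - b.1) / area2 a b c) * p.2.
Proof. by rewrite /bary {1}/area2; ring. Qed.

Lemma measurable_bary a b c : measurable_fun [set: RR * RR] (bary a b c : RR * RR -> RR).
Proof.
have /funext-> := baryE a b c; exact: measurable_affine2.
Qed.

Lemma measurable_simplex : measurable simplex.
Proof.
have -> : simplex = (fst @^-1` [set` `]0, +oo[%R]) `&`
   ((snd @^-1` [set` `]0, +oo[%R]) `&`
   ((fun q : RR * RR => q.1 + q.2 : RR) @^-1` [set` `]-oo, 1[%R])).
  apply/seteqP; split=> q /=; rewrite !in_itv/= !andbT; first by case.
  by case=> ? [].
apply: measurableI.
  by rewrite -[X in measurable X]setTI; apply: measurable_fst => //; exact: measurable_itv.
apply: measurableI.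
  by rewrite -[X in measurable X]setTI; apply: measurable_snd => //; exact: measurable_itv.
rewrite -[X in measurable X]setTI.
have : measurable_fun [set: RR * RR] (fun q : RR * RR => q.1 + q.2 : RR).
  exact: measurable_funD.
by apply => //; exact: measurable_itv.
Qed.

Lemma open_triangleE a b c : area2 a b c != 0 ->
  open_triangle a b c = (fun p : RR * RR => (bary b c a p, bary c a b p) : RR * RR) @^-1` simplex.
Proof.
move=> D0; apply/seteqP; split=> p /=; rewrite /open_triangle/simplex/= -(bary_sum p D0).
  by case=> *; split=> //; rewrite -addrA ltrDr.
by case=> ? ?; rewrite -addrA ltrDr.
Qed.

Lemma measurable_open_triangle a b c : measurable (open_triangle a b c).
Proof.
have -> : open_triangle a b c = (bary a b c @^-1` [set` `]0, +oo[%R]) `&`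
   ((bary b c a @^-1` [set` `]0, +oo[%R]) `&` (bary c a b @^-1` [set` `]0, +oo[%R])).
  by apply/seteqP; split=> q /=; rewrite !in_itv/= !andbT; [case|case=> ? []].
have m u v w : measurable (bary u v w @^-1` [set` `]0, +oo[%R] : set (RR * RR)).
  rewrite -[X in measurable X]setTI.
  by apply: measurable_bary => //; exact: measurable_itv.
by apply: measurableI => //; apply: measurableI.
Qed.

Definition closed_triangle a b c : set (RR * RR) :=
  [set p | [/\ 0 <= bary a b c p, 0 <= bary b c a p & 0 <= bary c a b p]].

Lemma measurable_closed_triangle a b c : measurable (closed_triangle a b c).
Proof.
have -> : closed_triangle a b c = (bary a b c @^-1` [set` `[0, +oo[%R]) `&`
   ((bary b c a @^-1` [set` `[0, +oo[%R]) `&` (bary c a b @^-1` [set` `[0, +oo[%R])).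
  by apply/seteqP; split=> q /=; rewrite !in_itv/= !andbT; [case|case=> ? []].
have m u v w : measurable (bary u v w @^-1` [set` `[0, +oo[%R] : set (RR * RR)).
  rewrite -[X in measurable X]setTI.
  by apply: measurable_bary => //; exact: measurable_itv.
by apply: measurableI => //; apply: measurableI.
Qed.

(** In barycentric variables the line through an edge becomes the product of a point and the real
    line, which is null. *)
Lemma bary_eq0_null a b c : area2 a b c != 0 ->
  measurable ([set p | bary b c a p = 0] : set (RR * RR)) /\
  area [set p | bary b c a p = 0] = 0%E.
Proof.
move=> D0.
have mL : measurable ([set p | bary b c a p = 0] : set (RR * RR)).
  rewrite (_ : mkset _ = bary b c a @^-1` [set 0])// -[X in measurable X]setTI.
  by apply: measurable_bary => //; exact: measurable_set1.
split=> //; rewrite -(setIT [set p | _]) -integral_indic//.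
rewrite (@integral_affine2 _ a.1 a.2 (b.1 - a.1) (c.1 - a.1) (b.2 - a.2) (c.2 - a.2)
  (fun p => (\1_[set p | bary b c a p = 0] p)%:E))//;
  last exact/measurable_EFinP/measurable_indic.
under eq_integral => q _.
    rewrite (_ : (\1_ _ _)%:E = (\1_([set 0] `*` [set: RR]) q : R)%:E); last first.
      rewrite !indicE; congr ((nat_of_bool _)%:R%:E).
      by apply/idP/idP; rewrite !inE/= bary_affine_fst//; case.
  over.
have m0 : measurable ([set 0] `*` [set: RR] : set (RR * RR)).
  by apply: measurableX => //; exact: measurable_set1.
rewrite integral_indic// setIT [X in (_ * X)%E](_ : _ = 0%E) ?mule0//.
transitivity (lebesgue_measure ([set 0%R] : set R) * lebesgue_measure [set: R])%E.
  by apply: product_measure1E => //; exact: measurable_set1.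
by rewrite lebesgue_measure_set1 mul0e.
Qed.

Lemma open_triangle_cycle a b c : open_triangle b c a = open_triangle a b c.
Proof. by apply/seteqP; split=> p [? ? ?]. Qed.

(** The map sending [q] to [a + q.1 (b - a) + q.2 (c - a)] has Jacobian [area2 a b c], and its
    inverse is given by the last two barycentric coordinates. *)
Lemma integral_triangle a b c (g : RR * RR -> R) : 0 < area2 a b c ->
  measurable_fun setT g -> (forall q, simplex q -> 0 <= g q) ->
  (\int[area]_(p in open_triangle a b c) (g (bary b c a p, bary c a b p))%:E =
   (area2 a b c)%:E * \int[area]_(q in simplex) (g q)%:E)%E.
Proof.
move=> Dgt0 mg g0; have D0 := lt0r_neq0 Dgt0.
pose H : RR * RR -> \bar R := (EFin \o g) \_ simplex.
have mH : measurable_fun setT H.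
  apply/(measurable_restrictT _ measurable_simplex)/measurable_EFinP.
  exact: measurable_funTS.
have H0 q : (0 <= H q)%E by apply: erestrict_ge0 => p Sp; rewrite lee_fin g0.
pose G (p : RR * RR) := H (bary b c a p, bary c a b p).
rewrite [LHS]integral_mkcond [X in (_ * X)%E]integral_mkcond.
rewrite [LHS](_ : _ = \int[area]_p G p)%E; last first.
  apply: eq_integral => p _; rewrite /G /H !patchE.
  have -> // : (p \in open_triangle a b c) =
      ((bary b c a p, bary c a b p) \in simplex).
  by rewrite open_triangleE//; apply/idP/idP; rewrite !inE.
rewrite (@integral_affine2 _ a.1 a.2 (b.1 - a.1) (c.1 - a.1) (b.2 - a.2) (c.2 - a.2) G)//.
- rewrite -/(area2 a b c) gtr0_norm//; congr (_ * _)%E.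
  by apply: eq_integral => q _; rewrite /G bary_affine_fst// bary_affine_snd//; case: q.
- apply: (measurableT_comp mH).
  exact: measurable_fun_pair (measurable_bary b c a) (measurable_bary c a b).
- by move=> p; exact: H0.
Qed.

(** The bound by 1 gives finiteness and the small square gives positivity. The square lies in the
    simplex and away from the diagonal: [q.1 >= 1/8] and [q.2 - q.1 >= 1/8] on it, so the bound
    [1/64] serves all the integrands [1], [q.1 ^ 2], [q.1 * q.2] and [(q.1 - q.2) ^ 2] below. *)
Lemma integral_simplex_gt0 (f : RR * RR -> R) : measurable_fun setT f ->
  (forall q, simplex q -> 0 <= f q <= 1) ->
  (forall q, 1/8 <= q.1 <= 1/4 -> 3/8 <= q.2 <= 1/2 -> 1/64 <= f q) ->
  (\int[area]_(q in simplex) (f q)%:E)%E = (\int[area]_(q in simplex) f q)%:E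
  /\ 0 < \int[area]_(q in simplex) f q.
Proof.
move=> mf f01 fQ.
have f0 q : simplex q -> 0 <= f q by move=> /f01/andP[].
have f1 q : simplex q -> f q <= 1 by move=> /f01/andP[].
pose Q : set (RR * RR) := [set` `[1/8, 1/4]%R] `*` [set` `[3/8, 1/2]%R].
pose S : set (RR * RR) := [set` `[0, 1]%R] `*` [set` `[0, 1]%R].
have mQ : measurable Q by apply: measurableX; exact: measurable_itv.
have mS : measurable S by apply: measurableX; exact: measurable_itv.
have mfin : measurable_fun setT (EFin \o f) by exact/measurable_EFinP.
have QS : Q `<=` simplex.
  by move=> [u v] []/=; rewrite /simplex !in_itv/= => ? ?; split=> /=; lra.
have SS : simplex `<=` S.
  by move=> [u v] []/= ? ? ?; split; rewrite /= in_itv/=; lra.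
have aQ : area Q = (1/64)%:E.
  transitivity (lebesgue_measure (`[1/8, 1/4]%classic : set R)%R *
      lebesgue_measure (`[3/8, 1/2]%classic : set R)%R)%E.
    by apply: product_measure1E; exact: measurable_itv.
  rewrite !lebesgue_measure_itv/= !lte_fin !ifT; [|lra..].
  by rewrite -!EFinD -EFinM; congr _%:E; field.
have aS : area S = 1%E.
  transitivity (lebesgue_measure (`[0, 1]%classic : set R)%R *
      lebesgue_measure (`[0, 1]%classic : set R)%R)%E.
    by apply: product_measure1E; exact: measurable_itv.
  by rewrite !lebesgue_measure_itv/= !lte_fin !ifT; [|lra..]; rewrite !oppr0 !adde0 mul1e.
have lo : ((1/64 * (1/64))%:E <= \int[area]_(q in simplex) (f q)%:E)%E.
  apply: (@le_trans _ _ (\int[area]_(q in Q) (f q)%:E)%E); last first.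
    apply: ge0_subset_integral => //; first exact: measurable_simplex.
    - exact: measurable_funTS.
  apply: (@le_trans _ _ (\int[area]_(q in Q) (1/64)%:E)%E); last first.
    apply: ge0_le_integral => //.
    - exact: measurable_funTS.
    - by move=> q [/=]; rewrite !in_itv/= lee_fin; exact: fQ.
  by rewrite integral_cst// [X in (_ * X)%E]aQ -EFinM.
have hi : (\int[area]_(q in simplex) (f q)%:E <= 1%:E)%E.
  apply: (@le_trans _ _ (\int[area]_(q in simplex) 1%:E)%E).
    apply: ge0_le_integral => //; first exact: measurable_simplex.
    - exact: measurable_funTS.
  rewrite integral_cst ?mul1e; last exact: measurable_simplex.
  apply: (@le_trans _ _ (area S)).
    by apply: le_measure => //; rewrite inE//; exact: measurable_simplex.
  by rewrite [leLHS]aS.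
rewrite /Rintegral.
have fin : (\int[area]_(q in simplex) (f q)%:E)%E \is a fin_num.
  rewrite ge0_fin_numE; first exact: le_lt_trans hi (ltry _).
  by apply: le_trans lo; rewrite lee_fin; lra.
rewrite fineK//; split=> //; apply: fine_gt0; apply/andP; split.
  by apply: lt_le_trans lo; rewrite lte_fin; lra.
by move: fin; rewrite ge0_fin_numE//; apply: le_trans lo; rewrite lee_fin; lra.
Qed.

Definition kappa_area : R := \int[area]_(q in simplex) 1.
Definition kappa_diag : R := \int[area]_(q in simplex) (q.1 * q.1).
Definition kappa_off : R := \int[area]_(q in simplex) (q.1 * q.2).

Lemma measurable_kernel (f g : RR * RR -> RR) : measurable_fun setT f ->
  measurable_fun setT g -> measurable_fun setT (fun q => f q * g q).
Proof. by move=> mf mg; exact: measurable_funM. Qed.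

Lemma kappa_areaP :
  (\int[area]_(q in simplex) 1%:E)%E = kappa_area%:E /\ 0 < kappa_area.
Proof. by apply: integral_simplex_gt0 => // q *; lra. Qed.

Lemma kappa_diagP :
  (\int[area]_(q in simplex) (q.1 * q.1)%:E)%E = kappa_diag%:E /\ 0 < kappa_diag.
Proof.
apply: integral_simplex_gt0; first exact: measurable_kernel.
- by move=> q [? ? ?]; nra.
- by move=> q /andP[? ?] /andP[? ?]; nra.
Qed.

Lemma kappa_offP :
  (\int[area]_(q in simplex) (q.1 * q.2)%:E)%E = kappa_off%:E /\ 0 < kappa_off.
Proof.
apply: integral_simplex_gt0; first exact: measurable_kernel.
- by move=> q [? ? ?]; nra.
- by move=> q /andP[? ?] /andP[? ?]; nra.
Qed.

Lemma integral_bary_diag a b c : 0 < area2 a b c ->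
  (\int[area]_(p in open_triangle a b c) (bary b c a p * bary b c a p)%:E =
   (area2 a b c * kappa_diag)%:E)%E.
Proof.
move=> D0; rewrite EFinM -kappa_diagP.1.
rewrite -(@integral_triangle a b c (fun q => q.1 * q.1))//.
  exact: measurable_kernel.
by move=> q [? _ _]; rewrite mulr_ge0// ltW.
Qed.

Lemma integral_bary_off a b c : 0 < area2 a b c ->
  (\int[area]_(p in open_triangle a b c) (bary b c a p * bary c a b p)%:E =
   (area2 a b c * kappa_off)%:E)%E.
Proof.
move=> D0; rewrite EFinM -kappa_offP.1.
rewrite -(@integral_triangle a b c (fun q => q.1 * q.2))//.
  exact: measurable_kernel.
by move=> q [? ? _]; rewrite mulr_ge0// ltW.
Qed.

(** The reference triangle, read from another starting vertex, has its second coordinate in the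
    place of the first. *)
Lemma kappa_diag_snd : (\int[area]_(q in simplex) (q.2 * q.2)%:E)%E = kappa_diag%:E.
Proof.
pose a : R * R := (0, 0); pose b : R * R := (1, 0); pose c : R * R := (0, 1).
have D1 : area2 a b c = 1 by rewrite /area2/=; ring.
have D0 : 0 < area2 a b c by rewrite D1.
have := @integral_bary_diag b c a; rewrite area2_cycle D1 mul1r => <- //.
rewrite open_triangle_cycle.
rewrite (@integral_triangle a b c (fun q => q.2 * q.2))// ?D1 ?mul1e//.
  exact: measurable_kernel.
by move=> q [_ ? _]; rewrite mulr_ge0// ltW.
Qed.

Lemma kappa_off_lt_diag : kappa_off < kappa_diag.
Proof.
have mB : measurable_fun [set: RR * RR] (fun q : RR * RR => q.1 - q.2 : RR).
  exact: measurable_funB.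
have [e e0] : (\int[area]_(q in simplex) ((q.1 - q.2) * (q.1 - q.2))%:E)%E =
    (\int[area]_(q in simplex) ((q.1 - q.2) * (q.1 - q.2)))%:E /\
    0 < \int[area]_(q in simplex) ((q.1 - q.2) * (q.1 - q.2)).
  apply: integral_simplex_gt0; first exact: measurable_kernel.
  - move=> q [? ? ?]; rewrite -expr2 sqr_ge0/=.
    have : 0 <= (1 - (q.1 - q.2)) * (1 + (q.1 - q.2)) by apply: mulr_ge0; lra.
    by lra.
  - by move=> q /andP[? ?] /andP[? ?]; nra.
set k := Rintegral _ _ _ in e e0.
have mS := measurable_simplex.
have mK (f g : RR * RR -> RR) : measurable_fun setT f ->
    measurable_fun setT g -> measurable_fun simplex (fun q => (f q * g q)%:E).
  move=> mf mg; rewrite (_ : (fun q => _) = EFin \o (fun q => f q * g q))//.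
  by apply/measurable_EFinP; apply: measurable_funTS; exact: measurable_kernel.
have pos (f : RR * RR -> R) : (forall q, simplex q -> 0 <= f q) ->
   (forall q, simplex q -> 0 <= (f q)%:E)%E by [].
(* The square of [q.1 - q.2] is expanded with all terms moved to their nonnegative side, so that
   additivity of nonnegative integrals suffices. The claim follows as [k > 0]. *)
have H : ((kappa_diag + kappa_diag)%:E = (k + (kappa_off + kappa_off))%:E)%E.
  rewrite !EFinD -[X in (X + _)%E = _]kappa_diagP.1 -kappa_diag_snd -e -kappa_offP.1.
  rewrite -!ge0_integralD//=; try exact: mK;
    try by move=> q [? ? ?]; rewrite lee_fin -?expr2 ?sqr_ge0//; nra.
  - by apply: eq_integral => q _; rewrite -!EFinD; congr _%:E; ring.
  - by apply: emeasurable_funD; exact: mK.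
have [] := H; lra.
Qed.

End Triangles.

Section BarycentricGeometry.
Variable R : realType.
Implicit Types a b c p : R * R.

Lemma bary_combination a b c (r s t : R) : area2 a b c != 0 -> r + s + t = 1 ->
  bary a b c (r *: a + s *: b + t *: c) = r.
Proof.
move=> D0 rst; rewrite /bary; apply: (mulIf D0); rewrite divfK// /area2/=.
have -> : r = 1 - s - t by rewrite -rst; ring.
by rewrite /GRing.scale/=; ring.
Qed.

Lemma combination_bary a b c p : area2 a b c != 0 ->
  p = bary a b c p *: a + bary b c a p *: b + bary c a b p *: c.
Proof.
move=> D0; rewrite /bary (area2_cycle a b c) (area2_cycle2 a b c).
rewrite /area2 in D0 *.
by apply: injective_projections; rewrite /= /GRing.scale/=; field.
Qed.

Lemma continuous_bary a b c : continuous (bary a b c).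
Proof.
have /funext-> := baryE a b c => p.
apply: cvgD; [apply: cvgD; [exact: cvg_cst|]|];
  apply: cvgM; by [exact: cvg_cst|exact: cvg_fst|exact: cvg_snd].
Qed.

Lemma derive_affine (f : R * R -> R) (r s t : R) (v p : R * R) :
  (forall q, f q = r + s * q.1 + t * q.2) -> 'D_v f p = s * v.1 + t * v.2.
Proof.
move=> fE; rewrite /derive; apply: cvg_lim => //.
apply: cvg_near_cst; near=> h.
have h0 : h != 0 by near: h; exact: nbhs_dnbhs_neq.
rewrite -[(_ \o _) _]/(f (h * v.1 + p.1, h * v.2 + p.2)) !fE/=.
by rewrite /GRing.scale/=; field.
Unshelve. all: by end_near. Qed.

End BarycentricGeometry.

Section Weights.
Variables (R : realType) (I : finType).

(* If q = sum_i w_i l_i = sum_j w'_j l_j, the double sum of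
   w_i w'_j (l_i - l_j) vanishes although its terms are nonnegative. *)
Lemma separated_weights (w w' l : I -> R) :
  (forall i, 0 <= w i) -> (forall i, 0 <= w' i) ->
  \sum_i w i = 1 -> \sum_i w' i = 1 ->
  \sum_i w i * l i = \sum_i w' i * l i ->
  (forall i j, w i != 0 -> w' j != 0 -> i != j -> l j < l i) -> w =1 w'.
Proof.
move=> w0 w'0 w1 w'1 wl sep.
have S0 : \sum_i \sum_j w i * w' j * (l i - l j) = 0.
  transitivity (\sum_i (w i * l i - w i * \sum_j w' j * l j)).
    apply: eq_bigr => i _; rewrite -[w i * l i]mulr1 -w'1 2!mulr_sumr -sumrB.
    by apply: eq_bigr => j _; ring.
  by rewrite sumrB -mulr_suml w1 mul1r wl subrr.
have ge0 i j : 0 <= w i * w' j * (l i - l j).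
  have [->|wi] := eqVneq (w i) 0; first by rewrite !mul0r.
  have [->|wj] := eqVneq (w' j) 0; first by rewrite mulr0 mul0r.
  have [->|ij] := eqVneq i j; first by rewrite subrr mulr0.
  by rewrite !mulr_ge0// subr_ge0 ltW// sep.
have z i j : i != j -> w i * w' j = 0.
  move=> ij; have /eqP : w i * w' j * (l i - l j) = 0.
    have/(_ _ i isT) := psumr_eq0P _ S0; last move=> /(_ _)Si.
    have /psumr_eq0P : \sum_j w i * w' j * (l i - l j) = 0.
      by apply: Si => // k _; apply: sumr_ge0.
    by apply.
  rewrite mulf_eq0 => /orP[/eqP//|]; rewrite subr_eq0 => /eqP e.
  have [->|wi] := eqVneq (w i) 0; first by rewrite !mul0r.
  have [->|wj] := eqVneq (w' j) 0; first by rewrite mulr0.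
  by have := sep _ _ wi wj ij; rewrite e ltxx.
(* All mixed products [w i * w' j] vanish, so both weights are concentrated at the same single
   index. *)
have [i wi] : exists i, w i != 0.
  apply: contrapT => h; have /eqP := w1.
  rewrite big1 ?(eq_sym 0) ?oner_eq0// => i _.
  by apply/eqP/negPn/negP => wi; apply: h; exists i.
have w'z j : j != i -> w' j = 0.
  rewrite eq_sym => ij; have /eqP := z i j ij.
  by rewrite mulf_eq0 (negbTE wi) => /eqP.
have w'i : w' i = 1 by rewrite -w'1 (bigD1 i)//= big1 ?addr0.
have wz j : j != i -> w j = 0.
  by move=> ji; have := z j i ji; rewrite w'i mulr1.
have w_i : w i = 1 by rewrite -w1 (bigD1 i)//= big1 ?addr0.
by move=> j; have [->|ji] := eqVneq j i; [rewrite w_i w'i|rewrite wz// w'z].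
Qed.

End Weights.

(** * Barycentric coordinates on a mesh *)

Section Connectivity.
Implicit Types (t : node * node * node) (e : node * node).

Definition verts t : seq node := [:: t.1.1; t.1.2; t.2].

Definition directed_edges t : seq (node * node) :=
  [:: (t.1.1, t.1.2); (t.1.2, t.2); (t.2, t.1.1)].

Definition rot3 t : node * node * node := (t.1.2, t.2, t.1.1).

(* With both triangles counterclockwise, a common edge is traversed in
   opposite directions. *)
Definition share_edge t t' : bool :=
  has (fun e => (e.2, e.1) \in directed_edges t') (directed_edges t).

Lemma triangulation_uniq t : t \in triangulation -> uniq (verts t).
Proof.
suff /allP : all (fun t => uniq (verts t)) triangulation by apply.
by vm_compute.
Qed.

Lemma triangulation_cover (i : node) : exists2 t, t \in triangulation & i \in verts t.
Proof.
have /allP/(_ (val i)) : all (fun m => has (fun t => m \in map val (verts t)) triangulation)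
  (iota 0 (7 + 6)) by vm_compute.
rewrite mem_iota ltn_ord => /(_ isT)/hasP[t tT].
by rewrite (mem_map val_inj) => it; exists t.
Qed.

Lemma triangulation_subset t t' : t \in triangulation -> t' \in triangulation ->
  {subset verts t <= verts t'} -> t = t'.
Proof.
suff /allP h : all (fun t => all (fun t' =>
   all (fun i => i \in verts t') (verts t) ==> (t == t')) triangulation) triangulation.
  move=> /h/allP{}h /h /implyP{}h s; apply/eqP/h/allP => i; exact: s.
by vm_compute.
Qed.

Lemma directed_edges_rot3 e t : e \in directed_edges t ->
  exists k c, iter k rot3 t = (e.1, e.2, c).
Proof.
case: t => [[i j] k]; rewrite !inE/= => /or3P[]/eqP->/=.
- by exists 0%N, k.
- by exists 1%N, i.
- by exists 2%N, j.
Qed.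

Lemma uniq_rot3 t : uniq (verts (rot3 t)) = uniq (verts t).
Proof. by rewrite -(rot_uniq 1 (verts t)). Qed.

End Connectivity.

Section Mesh.
Variable R : realType.
Implicit Types (x : node -> R * R) (t : node * node * node) (p : R * R).

Definition vertexwise (T : Type) (z : T) t (u v w : T) (i : node) : T :=
  if i == t.1.1 then u else if i == t.1.2 then v else if i == t.2 then w else z.

Definition tarea x t : R := area2 (x t.1.1) (x t.1.2) (x t.2).

(** The affine extension to the whole plane of what a nodal function does on [t]; it vanishes
    identically when [i] is not a vertex of [t]. *)
Definition hat x t (i : node) p : R :=
  vertexwise 0 t (bary (x t.1.1) (x t.1.2) (x t.2) p)
    (bary (x t.1.2) (x t.2) (x t.1.1) p) (bary (x t.2) (x t.1.1) (x t.1.2) p) i.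

Definition open_tri x t := open_triangle (x t.1.1) (x t.1.2) (x t.2).

(* A linear form which is larger on t than on t', strictly except at a shared
   vertex: an open condition in x, and it forces the two triangles to meet in
   at most that vertex. *)
Definition separated x t t' : Prop := exists r s : R,
  forall i j, i \in verts t -> j \in verts t' -> i != j ->
    r * (x j).1 + s * (x j).2 < r * (x i).1 + s * (x i).2.

(** Pairs with a common edge need no separating form: they traverse it in opposite directions, so
    positive areas already put them on opposite sides of it. *)
Definition valid_mesh x : Prop :=
  (forall t, t \in triangulation -> 0 < tarea x t) /\
  (forall t t', t \in triangulation -> t' \in triangulation -> t != t' ->
     ~~ share_edge t t' -> separated x t t').

Lemma vertexwise_out T (z : T) t u v w i : i \notin verts t -> vertexwise z t u v w i = z.
Proof. by rewrite !inE !negb_or /vertexwise => /and3P[/negbTE-> /negbTE-> /negbTE->]. Qed.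

Lemma sum_delta (k : node) (F : node -> R) : \sum_i (i == k)%:R * F i = F k.
Proof.
rewrite (bigD1 k)//= eqxx mul1r big1 ?addr0// => i /negbTE->.
by rewrite mul0r.
Qed.

Lemma vertexwise_sum t (u v w : R) i : uniq (verts t) -> vertexwise 0 t u v w i =
  (i == t.1.1)%:R * u + (i == t.1.2)%:R * v + (i == t.2)%:R * w.
Proof.
rewrite /= !inE negb_or andbT => /andP[/andP[n1 n2] n3]; rewrite /vertexwise.
have [->|i1] := eqVneq i t.1.1.
  by rewrite (negbTE n1) (negbTE n2) mul1r !mul0r !addr0.
have [->|i2] := eqVneq i t.1.2.
  by rewrite (negbTE n3) mul1r !mul0r addr0 add0r.
by case: eqP => _; rewrite ?mul1r !mul0r !add0r.
Qed.

Lemma sum_vertexwise t (u v w : R) (F : node -> R) : uniq (verts t) ->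
  \sum_i vertexwise 0 t u v w i * F i = u * F t.1.1 + v * F t.1.2 + w * F t.2.
Proof.
move=> ut; under eq_bigr => i _ do rewrite vertexwise_sum// 2!mulrDl -!mulrA.
by rewrite 2!big_split/= (sum_delta _ (fun i => u * F i))
  (sum_delta _ (fun i => v * F i)) (sum_delta _ (fun i => w * F i)).
Qed.

(** Barycentric coordinates reproduce affine functions. Applied to a constant and to a linear form,
    this makes the hats at [p] into weights with a prescribed mean, as required by
    [separated_weights]. *)
Lemma sum_hat x t p (r s q : R) : uniq (verts t) -> tarea x t != 0 ->
  \sum_i hat x t i p * (r + s * (x i).1 + q * (x i).2) = r + s * p.1 + q * p.2.
Proof.
move=> ut D0; rewrite sum_vertexwise// [in RHS](combination_bary p D0).
set u := bary _ _ _ _; set v := bary _ _ _ _; set w := bary _ _ _ _.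
have uvw : u + v + w = 1 by exact: bary_sum.
rewrite /= /GRing.scale/= -[r in RHS]mul1r -uvw.
by ring.
Qed.

Lemma triangleE x t p : 0 < tarea x t -> triangle x t p <->
  [/\ 0 <= bary (x t.1.1) (x t.1.2) (x t.2) p,
      0 <= bary (x t.1.2) (x t.2) (x t.1.1) p
    & 0 <= bary (x t.2) (x t.1.1) (x t.1.2) p].
Proof.
move=> /lt0r_neq0 D0; rewrite /triangle; case: t D0 => [[i j] k]/= D0; split.
  move=> [a [b [c [a0 b0 c0 abc ->]]]]; split.
  - by rewrite bary_combination.
  - rewrite -addrA addrC bary_combination ?(area2_cycle (x i))//.
    by rewrite -abc; ring.
  - rewrite addrC addrA bary_combination ?(area2_cycle2 (x i))//.
    by rewrite -abc; ring.
move=> [a0 b0 c0]; do 3 eexists; split; [exact: a0|exact: b0|exact: c0| |].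
- exact: bary_sum.
- exact: combination_bary.
Qed.

Lemma hat_ge0 x t p i : 0 < tarea x t -> triangle x t p -> 0 <= hat x t i p.
Proof.
move=> D0 /(triangleE _ D0)[? ? ?]; rewrite /hat/vertexwise.
by do !case: ifP => //.
Qed.

Lemma tarea_rot3 x t : tarea x (rot3 t) = tarea x t.
Proof. exact: area2_cycle. Qed.

Lemma hat_rot3 x t i p : uniq (verts t) -> hat x (rot3 t) i p = hat x t i p.
Proof.
move=> ut; rewrite /hat !vertexwise_sum ?uniq_rot3//=.
by ring.
Qed.

Lemma triangle_rot3 x t : 0 < tarea x t -> triangle x (rot3 t) = triangle x t.
Proof.
move=> D0; apply/seteqP; split=> p.
  by move=> /triangleE; rewrite tarea_rot3 => /(_ D0)[? ? ?]; apply/triangleE.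
by move=> /(triangleE _ D0)[? ? ?]; apply/triangleE; rewrite ?tarea_rot3.
Qed.

(** The two orientations of the edge give [area2 p a b] both signs at a common point, so that point
    lies on the edge line. The third coordinates vanish and the other two are determined by [p] and
    the endpoints. *)
Lemma hat_edge x t t' i p : 0 < tarea x t -> 0 < tarea x t' ->
  uniq (verts t) -> t'.1.1 = t.1.2 -> t'.1.2 = t.1.1 ->
  triangle x t p -> triangle x t' p -> hat x t i p = hat x t' i p.
Proof.
case: t t' => [[a b] c] [[a' b'] c']/= D0 D0' ut ea eb.
move: ea eb D0' => -> -> D0'.
have D := lt0r_neq0 D0; have D' := lt0r_neq0 D0'.
move=> /(triangleE _ D0)/=[u0 v0 w0] /(triangleE _ D0')/=[u'0 v'0 w'0].
rewrite /tarea/= in D D' D0 D0'.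
have pab : area2 p (x a) (x b) = 0.
  apply/eqP; rewrite eq_le; apply/andP; split.
    move: w'0; rewrite /bary (area2_cycle2 (x b) (x a) (x c')) pmulr_lge0 ?invr_gt0//.
    by rewrite -oppr_le0; congr (_ <= 0); rewrite /area2; ring.
  by move: w0; rewrite /bary (area2_cycle2 (x a) (x b) (x c)) pmulr_lge0 ?invr_gt0.
have pba : area2 p (x b) (x a) = 0.
  by apply/eqP; rewrite -oppr_eq0 -pab /area2; apply/eqP; ring.
have w'z : bary (x c') (x b) (x a) p = 0 by rewrite /bary pba mul0r.
have wz : bary (x c) (x a) (x b) p = 0 by rewrite /bary pab mul0r.
have p' := combination_bary p D'; rewrite w'z scale0r addr0 in p'.
have s' := bary_sum p D'; rewrite w'z addr0 in s'.
have u_ : bary (x a) (x b) (x c) p = bary (x a) (x c') (x b) p.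
  rewrite {1}p' addrC -[_ + _]addr0 -(scale0r (x c)) bary_combination//.
  by rewrite addr0 addrC.
have v_ : bary (x b) (x c) (x a) p = bary (x b) (x a) (x c') p.
  rewrite {1}p' -[_ + _]addr0 addrAC -(scale0r (x c)).
  by rewrite bary_combination ?addr0// (area2_cycle (x a)).
rewrite /hat/vertexwise/= wz w'z u_ v_.
have [->|_] := eqVneq i a.
  by have [ab|//] := eqVneq a b; move: ut; rewrite /= ab !inE eqxx.
by case: eqP => // _; rewrite !if_same.
Qed.

Lemma hat_share_edge x t t' i p : 0 < tarea x t -> 0 < tarea x t' ->
  uniq (verts t) -> uniq (verts t') -> share_edge t t' ->
  triangle x t p -> triangle x t' p -> hat x t i p = hat x t' i p.
Proof.
move=> D0 D0' ut ut' /hasP[e /directed_edges_rot3[k [c tk]]].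
move=> /directed_edges_rot3[k' [c' tk']] tp tp'.
have iterE s n : uniq (verts s) -> 0 < tarea x s ->
  [/\ uniq (verts (iter n rot3 s)), 0 < tarea x (iter n rot3 s),
   triangle x (iter n rot3 s) = triangle x s & hat x (iter n rot3 s) i p = hat x s i p].
  move=> us Ds; elim: n => [//|n [un Dn tn hn]]; rewrite iterS; split.
  - by rewrite uniq_rot3.
  - by rewrite tarea_rot3.
  - by rewrite triangle_rot3.
  - by rewrite hat_rot3.
have [u1 D1 t1 <-] := iterE t k ut D0.
have [u2 D2 t2 <-] := iterE t' k' ut' D0'.
apply: hat_edge => //.
- by rewrite tk tk'.
- by rewrite tk tk'.
- by rewrite t1.
- by rewrite t2.
Qed.

(** Conformity of the mesh. Without a common edge, the hats of [t] and of [t'] at [p] are two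
    systems of weights on nodes with the same mean of the separating form, hence equal by
    [separated_weights]. *)
Lemma hat_consistent x t t' i p : valid_mesh x ->
  t \in triangulation -> t' \in triangulation ->
  triangle x t p -> triangle x t' p -> hat x t i p = hat x t' i p.
Proof.
move=> [D sep] tT t'T tp t'p; have [->//|tt'] := eqVneq t t'.
have [ut ut'] := (triangulation_uniq tT, triangulation_uniq t'T).
have [Dt Dt'] := (D _ tT, D _ t'T).
have [|/(sep _ _ tT t'T tt')[r [s rs]]] := boolP (share_edge t t').
  by move=> e; exact: hat_share_edge.
have hat1 u : uniq (verts u) -> 0 < tarea x u -> \sum_i hat x u i p = 1.
  move=> uu /lt0r_neq0 Du; have := sum_hat p 1 0 0 uu Du.
  rewrite !mul0r !addr0 => <-; apply: eq_bigr => j _.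
  by rewrite !mul0r !addr0 mulr1.
have hatl u : uniq (verts u) -> 0 < tarea x u ->
    \sum_i hat x u i p * (0 + r * (x i).1 + s * (x i).2) = 0 + r * p.1 + s * p.2.
  by move=> uu /lt0r_neq0 Du; exact: sum_hat.
apply: (@separated_weights _ _ _ _ (fun i => 0 + r * (x i).1 + s * (x i).2)).
- by move=> j; exact: hat_ge0.
- by move=> j; exact: hat_ge0.
- exact: hat1.
- exact: hat1.
- by rewrite !hatl.
- move=> j k hj hk jk; rewrite !add0r; apply: rs => //.
    by apply: contraNT hj => jt; rewrite /hat vertexwise_out.
  by apply: contraNT hk => kt; rewrite /hat vertexwise_out.
Qed.

Lemma open_tri_sub x t : 0 < tarea x t -> open_tri x t `<=` triangle x t.
Proof. by move=> D0 p [? ? ?]; apply/triangleE => //; split; exact: ltW. Qed.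

(** At an interior point of [t] the hats of all its vertices are positive; by consistency these
    vertices are then vertices of [t']. *)
Lemma open_tri_disjoint x t t' p : valid_mesh x ->
  t \in triangulation -> t' \in triangulation ->
  open_tri x t p -> triangle x t' p -> t = t'.
Proof.
move=> vx tT t'T tp t'p; apply: triangulation_subset => // i it.
have tp' : triangle x t p by apply: open_tri_sub => //; exact: vx.1.
have : 0 < hat x t i p.
  move: tp it => [u v w]; rewrite !inE /hat/vertexwise.
  by case: eqP => //; case: eqP => //; case: eqP.
rewrite (hat_consistent i vx tT t'T tp' t'p).
by apply: contraTT => it'; rewrite /hat vertexwise_out// ltxx.
Qed.

Lemma vertex_triangle x t i : 0 < tarea x t -> i \in verts t -> triangle x t (x i).
Proof.
move=> D0; case: t D0 => [[a b] c] D0; rewrite !inE/= => /or3P[]/eqP->.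
- by exists 1, 0, 0; split; rewrite ?ler01 ?scale1r ?scale0r ?addr0.
- by exists 0, 1, 0; split; rewrite ?ler01 ?scale1r ?scale0r ?addr0 ?add0r.
- by exists 0, 0, 1; split; rewrite ?ler01 ?scale1r ?scale0r ?addr0 ?add0r.
Qed.

Lemma hat_vertex x t i j : 0 < tarea x t -> uniq (verts t) -> j \in verts t ->
  hat x t i (x j) = (i == j)%:R.
Proof.
move=> /lt0r_neq0 D0 ut jt.
have E0 (a b c : R * R) : area2 a b c != 0 ->
    [/\ bary a b c a = 1, bary a b c b = 0 & bary a b c c = 0].
  by move=> D; split; rewrite /bary ?divff// (_ : area2 _ b c = 0) ?mul0r// /area2; ring.
have [a1 a2 a3] := E0 _ _ _ D0.
have [|b1 b2 b3] := E0 (x t.1.2) (x t.2) (x t.1.1); first by rewrite area2_cycle.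
have [|c1 c2 c3] := E0 (x t.2) (x t.1.1) (x t.1.2); first by rewrite area2_cycle2.
rewrite /hat vertexwise_sum//; move: ut jt; rewrite /= !inE negb_or andbT.
move=> /andP[/andP[n1 n2] n3] /or3P[]/eqP->.
- by rewrite a1 b3 c2 !mulr0 !addr0 mulr1.
- by rewrite a2 b1 c3 !mulr0 addr0 add0r mulr1.
- by rewrite a3 b2 c1 !mulr0 !add0r mulr1.
Qed.

End Mesh.

(** * Nodal basis functions *)

Section NodalBasis.
Variable R : realType.
Local Notation area := (@lebesgue_measure R \x @lebesgue_measure R)%E.
Local Notation RR := (measurableTypeR R).
Implicit Types (x : node -> R * R) (t : node * node * node) (p : R * R).

Definition closed_tri x t := closed_triangle (x t.1.1) (x t.1.2) (x t.2).

Lemma triangle_closed_tri x t : 0 < tarea x t -> triangle x t = closed_tri x t.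
Proof. by move=> D0; apply/seteqP; split=> p /(triangleE p D0). Qed.

Lemma closed_closed_tri x t : closed (closed_tri x t).
Proof.
have c (u v w : R * R) : closed (bary u v w @^-1` [set r | 0 <= r]).
  have /continuous_closedP := @continuous_bary _ u v w.
  by apply; exact: closed_ge.
rewrite [closed_tri x t](_ : _ = bary (x t.1.1) (x t.1.2) (x t.2) @^-1` [set r | 0 <= r] `&`
  (bary (x t.1.2) (x t.2) (x t.1.1) @^-1` [set r | 0 <= r] `&`
   bary (x t.2) (x t.1.1) (x t.1.2) @^-1` [set r | 0 <= r])).
  by apply: closedI => //; apply: closedI.
by apply/seteqP; split=> p /=; [case|case=> ? []].
Qed.

Lemma open_open_tri x t : open (open_tri x t).
Proof.
have c (u v w : R * R) : open (bary u v w @^-1` [set r | 0 < r]).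
  have /continuousP := @continuous_bary _ u v w.
  by apply; exact: open_gt.
rewrite [open_tri x t](_ : _ = bary (x t.1.1) (x t.1.2) (x t.2) @^-1` [set r | 0 < r] `&`
  (bary (x t.1.2) (x t.2) (x t.1.1) @^-1` [set r | 0 < r] `&`
   bary (x t.2) (x t.1.1) (x t.1.2) @^-1` [set r | 0 < r])).
  by apply: openI => //; apply: openI.
by apply/seteqP; split=> p /=; [case|case=> ? []].
Qed.

(* If bary a b c p = 0, moving p slightly away from a leaves the triangle. *)
Lemma interior_bary_gt0 (a b c p : R * R) (A : set (R * R)) : area2 a b c != 0 ->
  (forall q, A q -> 0 <= bary a b c q) -> A° p -> 0 < bary a b c p.
Proof.
move=> D0 A0 Ap; have /A0 := interior_subset Ap.
rewrite le_eqVlt => /predU1P[p0|//]; exfalso.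
have cont : (fun h : R => p + h *: (p - a)) @ (0 : R) --> p.
  rewrite -[X in _ --> X]addr0 -(scale0r (p - a)).
  by apply: cvgD; [exact: cvg_cst|apply: cvgZr_tmp; exact: cvg_id].
have [h [h0 Ah]] : exists h : R, 0 < h /\ A (p + h *: (p - a)).
  have : \forall h \near (0 : R), A (p + h *: (p - a)) by exact: cont.
  move=> /nbhs_ballP[e/= e0 eA]; exists (e / 2); split; first by rewrite divr_gt0.
  apply: eA; rewrite /ball/= sub0r normrN gtr0_norm ?divr_gt0//.
  by rewrite ltr_pdivrMr// ltr_pMr// ltr1n.
have := A0 _ Ah; have -> : bary a b c (p + h *: (p - a)) = (1 + h) * bary a b c p - h.
  rewrite {1}/bary; apply: (mulIf D0); rewrite divfK//.
  rewrite mulrBl -mulrA /bary divfK// /area2/= /GRing.scale/=; ring.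
by rewrite -p0; lra.
Qed.

Lemma interior_triangle x t : 0 < tarea x t -> (triangle x t)° = open_tri x t.
Proof.
move=> Dt; apply/seteqP; split; last first.
  by rewrite -open_subsetE; [exact: open_tri_sub|exact: open_open_tri].
move=> p tp; have D0 := lt0r_neq0 Dt; split.
- by apply: interior_bary_gt0 tp => // q /(triangleE q Dt)[].
- apply: interior_bary_gt0 tp; first by rewrite (area2_cycle (x t.1.1)).
  by move=> q /(triangleE q Dt)[].
- apply: interior_bary_gt0 tp; first by rewrite (area2_cycle2 (x t.1.1)).
  by move=> q /(triangleE q Dt)[].
Qed.

(** The first set of the list that contains [p] decides, which makes measurability a plain
    induction. Overlaps are harmless once the pieces agree there. *)
Definition glue (s : seq (node * node * node)) (S : node * node * node -> set (R * R))
    (F : node * node * node -> R * R -> R) p : R :=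
  foldr (fun t acc => if p \in S t then F t p else acc) 0 s.

Lemma glueE s S F t p : t \in s -> S t p ->
  (forall t', t' \in s -> S t' p -> F t' p = F t p) -> glue s S F p = F t p.
Proof.
move=> + tp; elim: s => [//|u s ih]; rewrite inE => ts H /=.
case: ifPn => [/set_mem up|up]; first by apply: H => //; rewrite mem_head.
apply: ih => [|t' t's]; last by apply: H; rewrite inE t's orbT.
by move: ts => /orP[/eqP tu|//]; move: up; rewrite -tu => /negP[]; rewrite inE.
Qed.

Lemma measurable_glue s S F : (forall t, measurable (S t : set (RR * RR))) ->
  (forall t, measurable_fun setT (F t : RR * RR -> RR)) ->
  measurable_fun setT (glue s S F : RR * RR -> RR).
Proof.
move=> mS mF; elim: s => [|t s ih] /=; first exact: measurable_cst.
apply: measurable_fun_ifT => //; apply: (measurable_fun_bool true).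
rewrite setTI (_ : _ @^-1` _ = S t)//.
by apply/seteqP; split=> p /=; [move/set_mem|move/mem_set].
Qed.

Lemma measurable_hat x t i : measurable_fun setT (hat x t i : RR * RR -> RR).
Proof.
rewrite /hat/vertexwise; do 3 (case: (i == _); first exact: measurable_bary).
exact: measurable_cst.
Qed.

Lemma continuous_hat x t i : continuous (hat x t i).
Proof.
rewrite /hat/vertexwise; do 3 (case: (i == _); first exact: continuous_bary).
exact: cst_continuous.
Qed.

Definition nodal x i : R * R -> R := glue triangulation (triangle x) (fun t => hat x t i).

Section Valid.
Variables (x : node -> R * R) (vx : valid_mesh x).

Lemma nodalE i t p : t \in triangulation -> triangle x t p -> nodal x i p = hat x t i p.
Proof.
move=> tT tp; rewrite /nodal (glueE (t := t))// => t' t'T t'p.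
exact: hat_consistent.
Qed.

Lemma nodal_basis i : is_nodal_basis_function x i (nodal x i).
Proof.
split.
(* Pasting of continuous functions on finitely many closed sets; closedness of the partial union has
   to be carried through the induction. *)
- rewrite /domain; suff H (s : seq (node * node * node)) : {subset s <= triangulation} ->
    closed (\bigcup_(t in [set` s]) triangle x t) /\
    {within \bigcup_(t in [set` s]) triangle x t, continuous (nodal x i)}.
    exact: (H triangulation _).2.
  elim: s => [_|t s ih sT].
    rewrite bigcup_seq big_nil; split; first exact: closed0.
    exact: continuous_subspace0.
  have [|cs ws] := ih; first by move=> u us; apply: sT; rewrite inE us orbT.
  have tT : t \in triangulation by apply: sT; rewrite mem_head.
  rewrite bigcup_seq big_cons -bigcup_seq.
  have ct : closed (triangle x t).
    by rewrite triangle_closed_tri; [exact: closed_closed_tri|exact: vx.1].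
  split; first exact: closedU.
  apply: withinU_continuous => //.
  apply: (@subspace_eq_continuous _ _ _ (hat x t i)).
    by move=> p /set_mem tp; symmetry; exact: nodalE.
  by apply: continuous_subspaceT; exact: continuous_hat.
- move=> t tT; have D0 := lt0r_neq0 (vx.1 t tT).
  suff [a [b [c abc]]] : exists a b c, forall p, hat x t i p = a * p.1 + b * p.2 + c.
    by exists a, b, c => p tp; rewrite (nodalE i tT tp) abc.
  rewrite /hat/vertexwise; do 3 (case: (i == _);
    first by do 3 eexists; move=> p; rewrite baryE -addrA addrC).
  by exists 0, 0, 0 => p; rewrite !mul0r !addr0.
- move=> j; have [t tT jt] := triangulation_cover j.
  have Dt := vx.1 t tT.
  rewrite (nodalE i tT) ?hat_vertex//; last exact: vertex_triangle.
  exact: triangulation_uniq.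
Qed.

(** [nodal] shows that a nodal basis function exists, so the chosen one has the defining properties;
    an affine function on a triangle is then determined by its values at the vertices. *)
Lemma phiE i t p : t \in triangulation -> triangle x t p -> phi x i p = hat x t i p.
Proof.
move=> tT tp.
have [_ aff vert] : is_nodal_basis_function x i (phi x i).
  by apply: xgetPex; exists (nodal x i); exact: nodal_basis.
have Dt := vx.1 t tT; have D0 := lt0r_neq0 Dt.
have ut := triangulation_uniq tT.
have [a [b [c abc]]] := aff t tT; rewrite abc//.
transitivity (c + a * p.1 + b * p.2); first by ring.
rewrite -(sum_hat p c a b ut D0).
transitivity (\sum_j hat x t j p * (i == j)%:R).
  apply: eq_bigr => j _; have [jt|jt] := boolP (j \in verts t); last first.
    by rewrite /hat vertexwise_out// !mul0r.
  by rewrite -vert abc; [congr (_ * _); ring|exact: vertex_triangle].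
rewrite (bigD1 i)//= eqxx mulr1 big1 ?addr0// => j ji.
by rewrite eq_sym (negbTE ji) mulr0.
Qed.

Lemma trivIset_open_tri : trivIset [set` triangulation] (open_tri x).
Proof.
move=> t t' /= tT t'T [p [tp t'p]].
apply: (open_tri_disjoint vx tT t'T tp); apply: open_tri_sub t'p; exact: vx.1.
Qed.

Lemma measurable_open_tri t : measurable (open_tri x t : set (RR * RR)).
Proof. exact: measurable_open_triangle. Qed.

Lemma measurable_closed_tri t : measurable (closed_tri x t : set (RR * RR)).
Proof. exact: measurable_closed_triangle. Qed.

(** Nothing is assumed of [f] off the open triangles, in particular no measurability; it is replaced
    by the glued pieces before the integral is split. *)
Lemma integral_open_mesh (f : R * R -> R) (F : node * node * node -> RR * RR -> RR) :
  (forall t p, t \in triangulation -> open_tri x t p -> f p = F t p) ->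
  (forall t, measurable_fun setT (F t)) ->
  (\int[area]_(p in \bigcup_(t in [set` triangulation]) open_tri x t) (f p)%:E =
   \sum_(t <- triangulation) \int[area]_(p in open_tri x t) (F t p)%:E)%E.
Proof.
move=> fF mF; pose g := glue triangulation (open_tri x) F.
have gE t p : t \in triangulation -> open_tri x t p -> g p = F t p.
  move=> tT tp; apply: glueE => // t' t'T t'p.
  suff -> : t' = t by [].
  by apply: trivIset_open_tri => //; exists p.
have mg : measurable_fun setT (g : RR * RR -> RR).
  by apply: measurable_glue => //; exact: measurable_open_tri.
transitivity (\int[area]_(p in \bigcup_(t in [set` triangulation]) open_tri x t) (g p)%:E)%E.
  apply: eq_integral => p /set_mem[t tT tp].
  by rewrite (fF t)// (gE t).
rewrite bigcup_seq (@integral_bigsetU_EFin _ _ _ area _ (open_tri x) g)//.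
- apply: eq_big_seq => t tT; apply: eq_integral => p /set_mem tp.
  by rewrite (gE t).
- exact: measurable_open_tri.
- exact: trivIset_open_tri.
- by apply/measurable_EFinP; exact: measurable_funTS.
Qed.

End Valid.
End NodalBasis.

(** * Assembly of the stiffness and mass matrices *)

Section Assembly.
Variable R : realType.
Local Notation area := (@lebesgue_measure R \x @lebesgue_measure R)%E.
Local Notation RR := (measurableTypeR R).
Implicit Types (x : node -> R * R) (t : node * node * node) (p : R * R).

(** The edge vector from [b] to [c] after a quarter turn, that is [area2 a b c] times the gradient
    of [bary a b c]. *)
Definition normal (b c : R * R) : R * R := (b.2 - c.2, c.1 - b.1).

Definition normal_at x t (i : node) : R * R :=
  vertexwise (0, 0) t (normal (x t.1.2) (x t.2)) (normal (x t.2) (x t.1.1))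
    (normal (x t.1.1) (x t.1.2)) i.

Definition dot (v w : R * R) : R := v.1 * w.1 + v.2 * w.2.

(** The gradients are normals divided by [tarea], and the triangle has measure [kappa_area * tarea],
    so one power of [tarea] remains in the denominator. *)
Definition local_stiffness x t i j : R :=
  kappa_area R * dot (normal_at x t i) (normal_at x t j) / tarea x t.

Definition local_mass x t (i j : node) : R :=
  tarea x t * (if (i \in verts t) && (j \in verts t) then
               if i == j then kappa_diag R else kappa_off R else 0).

Lemma derive_hat x t i v p :
  'D_v (hat x t i) p = dot (normal_at x t i) v / tarea x t.
Proof.
have D_bary (a b c : R * R) : 'D_v (bary a b c) p = dot (normal b c) v / area2 a b c.
  by rewrite (derive_affine _ _ (baryE a b c)) /dot/=; ring.
rewrite /hat /normal_at /vertexwise /tarea.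
case: (i == _); first exact: D_bary.
case: (i == _); first by rewrite -(area2_cycle (x t.1.1)); exact: D_bary.
case: (i == _); first by rewrite -(area2_cycle2 (x t.1.1)); exact: D_bary.
by rewrite derive_cst /dot/= !mul0r addr0 mul0r.
Qed.

Lemma integral_hat2 x t i j : 0 < tarea x t -> uniq (verts t) ->
  (\int[area]_(p in open_tri x t) (hat x t j p * hat x t i p)%:E =
   (local_mass x t i j)%:E)%E.
Proof.
rewrite /local_mass /open_tri /tarea.
case: t => [[k l] m]/=; set a := x k; set b := x l; set c := x m => D0 ut.
have diag (u v w : R * R) : 0 < area2 u v w ->
    (\int[area]_(p in open_triangle u v w) (bary u v w p * bary u v w p)%:E =
     (area2 u v w * kappa_diag R)%:E)%E.
  by rewrite -(area2_cycle2 u) (open_triangle_cycle w) => D; exact: integral_bary_diag.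
have off (u v w : R * R) : 0 < area2 u v w ->
    (\int[area]_(p in open_triangle u v w) (bary u v w p * bary v w u p)%:E =
     (area2 u v w * kappa_off R)%:E)%E.
  by rewrite -(area2_cycle2 u) (open_triangle_cycle w) => D; exact: integral_bary_off.
have off' (u v w : R * R) : 0 < area2 u v w ->
    (\int[area]_(p in open_triangle u v w) (bary v w u p * bary u v w p)%:E =
     (area2 u v w * kappa_off R)%:E)%E.
  by move=> D; rewrite -off//; apply: eq_integral => p _; rewrite mulrC.
have D1 : 0 < area2 b c a by rewrite (area2_cycle a).
have D2 : 0 < area2 c a b by rewrite (area2_cycle2 a).
have z0 : (\int[area]_(p in open_triangle a b c) 0%:E = (area2 a b c * 0)%:E)%E.
  by rewrite integral0 mulr0.
move: ut; rewrite /= !inE negb_or andbT => /andP[/andP[kl km] lm].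
rewrite /hat/vertexwise/= -/a -/b -/c.
have [->|ik] := eqVneq i k; have [->|jk] := eqVneq j k;
 rewrite /= ?(negbTE kl) ?(negbTE km) ?eqxx/=.
- exact: diag.
- case: eqP => _; first exact: off'.
  case: eqP => _ /=; first by have := off _ _ _ D2;
    rewrite (area2_cycle2 a) -(open_triangle_cycle c).
  by under eq_integral do rewrite mul0r.
- rewrite ?(negbTE ik).
  case: eqP => _; first exact: off.
  case: eqP => _ /=; first by have := off' _ _ _ D2;
    rewrite (area2_cycle2 a) -(open_triangle_cycle c).
  by under eq_integral do rewrite mulr0.
- have [->|il] := eqVneq i l; have [->|jl] := eqVneq j l; rewrite /= ?eqxx ?(negbTE lm).
  + by have := diag _ _ _ D1; rewrite (area2_cycle a) (open_triangle_cycle a).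
  + case: eqP => _; first by have := off' _ _ _ D1; rewrite (area2_cycle a) (open_triangle_cycle a).
    by under eq_integral do rewrite mul0r.
  + rewrite ?(negbTE il).
    case: eqP => _; first by have := off _ _ _ D1; rewrite (area2_cycle a) (open_triangle_cycle a).
    by under eq_integral do rewrite mulr0.
  + have [im|im] := eqVneq i m; have [jm|jm] := eqVneq j m; rewrite /= ?im ?jm ?eqxx.
    * by have := diag _ _ _ D2; rewrite (area2_cycle2 a) -(open_triangle_cycle c).
    * by under eq_integral do rewrite mul0r.
    * by under eq_integral do rewrite mulr0.
    * by under eq_integral do rewrite mulr0.
Qed.

Section Valid.
Variables (x : node -> R * R) (vx : valid_mesh x).

Lemma domain_off_edgesE :
  domain_off_edges x = \bigcup_(t in [set` triangulation]) open_tri x t.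
Proof.
by apply: eq_bigcupr => t tT; apply: interior_triangle; exact: vx.1.
Qed.

Lemma stiffnessE i j :
  stiffness x i j = \sum_(t <- triangulation) local_stiffness x t i j.
Proof.
rewrite mxE /Rintegral domain_off_edgesE.
rewrite (@integral_open_mesh _ _ vx (dotgrad (phi x j) (phi x i)) (fun t _ =>
   dot (normal_at x t i) (normal_at x t j) / tarea x t ^+ 2)).
- rewrite (eq_big_seq (fun t => (local_stiffness x t i j)%:E)) ?sumEFin// => t tT.
  have := vx.1 t tT => Dt.
  have k1 : (\int[area]_(p in open_tri x t) 1%:E = (tarea x t * kappa_area R)%:E)%E.
    by rewrite EFinM -(kappa_areaP R).1 -(@integral_triangle _ _ _ _ (fun=> 1)).
  rewrite integral_cst; last exact: measurable_open_tri.
  move: k1; rewrite integral_cst ?mul1e; last exact: measurable_open_tri.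
  move=> ->; rewrite -EFinM /local_stiffness; congr _%:E.
  by field; rewrite lt0r_neq0.
- move=> t p tT tp.
  (* Derivatives at [p] depend on [phi] near [p] only, and the open triangle is a neighbourhood on
     which [phi] is known. *)
  have E k : \forall q \near p, phi x k q = hat x t k q.
    have : nbhs p (open_tri x t) by by apply: open_nbhs_nbhs; split => //; exact: open_open_tri.
    by apply: filterS => q tq; apply: phiE => //; apply: open_tri_sub tq; exact: vx.1.
  rewrite /dotgrad !(near_eq_derive _ (E i)) !(near_eq_derive _ (E j)) !derive_hat /dot/=.
  have := lt0r_neq0 (vx.1 t tT) => D0.
  by field.
- by move=> t; exact: measurable_cst.
Qed.

Lemma closed_minus_open_null t : t \in triangulation ->
  area.-negligible (closed_tri x t `\` open_tri x t).
Proof.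
move=> tT; have D0 := lt0r_neq0 (vx.1 t tT).
pose N (a b c : R * R) : set (RR * RR) := [set p | bary a b c p = 0].
have nN (a b c : R * R) : area2 b c a != 0 -> area.-negligible (N b c a).
  by rewrite (area2_cycle a) => /bary_eq0_null[m0 e]; exact/negligibleP.
apply: (@negligibleS _ _ _ _ (N (x t.1.1) (x t.1.2) (x t.2) `|`
  (N (x t.1.2) (x t.2) (x t.1.1) `|` N (x t.2) (x t.1.1) (x t.1.2)))).
  move=> p [[u0 v0 w0] np].
  have [u|u] := eqVneq (bary (x t.1.1) (x t.1.2) (x t.2) p) 0; first by left.
  have [v|v] := eqVneq (bary (x t.1.2) (x t.2) (x t.1.1) p) 0; first by right; left.
  have [w|w] := eqVneq (bary (x t.2) (x t.1.1) (x t.1.2) p) 0; first by right; right.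
  by case: np; split; rewrite lt0r ?u ?v ?w.
by apply: negligibleU; [|apply: negligibleU]; apply: nN;
  rewrite ?(area2_cycle (x t.1.1)) ?(area2_cycle2 (x t.1.1)).
Qed.

Lemma massE i j : mass x i j = \sum_(t <- triangulation) local_mass x t i j.
Proof.
rewrite mxE /Rintegral.
have domE : domain x = \bigcup_(t in [set` triangulation]) closed_tri x t.
  by apply: eq_bigcupr => t tT; apply: triangle_closed_tri; exact: vx.1.
have mD : measurable (domain x : set (RR * RR)).
  rewrite domE bigcup_seq; apply: bigsetU_measurable => t _.
  exact: measurable_closed_tri.
pose U : set (RR * RR) := \bigcup_(t in [set` triangulation]) open_tri x t.
have mU : measurable U.
  rewrite /U bigcup_seq; apply: bigsetU_measurable => t _.
  exact: measurable_open_tri.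
have UD : U `<=` domain x.
  by move=> p [t tT tp]; exists t => //; apply: open_tri_sub tp; exact: vx.1.
pose f p := nodal x j p * nodal x i p.
have mn k : measurable_fun setT (nodal x k : RR * RR -> RR).
  rewrite (_ : nodal x k = glue triangulation (closed_tri x) (fun t => hat x t k)).
    by apply: measurable_glue => t; [exact: measurable_closed_tri|exact: measurable_hat].
  apply/funext => p; rewrite /nodal /glue.
  have : {in triangulation, forall t, triangle x t = closed_tri x t}.
    by move=> t tT; apply: triangle_closed_tri; exact: vx.1.
  elim: triangulation => [//|t s ih] /= H.
  rewrite (H t) ?mem_head// ih// => u us.
  by apply: H; rewrite inE us orbT.
have mf : measurable_fun setT (f : RR * RR -> RR).
  by apply: measurable_funM; exact: mn.
(* [phi] is known on the closed triangles only; [nodal] agrees with it there and is measurable on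
   the whole plane. *)
have -> : (\int[area]_(p in domain x) (phi x j p * phi x i p)%:E =
           \int[area]_(p in domain x) (f p)%:E)%E.
  apply: eq_integral => p /set_mem[t tT tp].
  by rewrite /f !(phiE vx _ tT tp) !(nodalE vx _ tT tp).
have f0 p : domain x p -> 0 <= f p.
  move=> [t tT tp]; rewrite /f !(nodalE vx _ tT tp).
  by rewrite mulr_ge0// hat_ge0// vx.1.
(* The mass is integrated over closed triangles, which overlap in edges; these are null and are
   discarded before splitting. *)
have mN : measurable (domain x `\` U : set (RR * RR)) by exact: measurableD.
have N0 : area (domain x `\` U) = 0%E.
  apply/negligibleP => //; apply: (@negligibleS _ _ _ _
    (\big[setU/set0]_(t <- triangulation) (closed_tri x t `\` open_tri x t))).
    move=> p [+ Up]; rewrite domE => -[t tT tp]; rewrite -bigcup_seq.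
    by exists t => //; split => // tp'; apply: Up; exists t.
  rewrite big_seq; apply: (big_ind (fun A => area.-negligible A)).
  - exact: negligible_set0.
  - exact: negligibleU.
  - exact: closed_minus_open_null.
rewrite (ge0_negligible_integral mN mD _ _ N0); last 2 first.
- by apply/measurable_EFinP; exact: measurable_funTS.
- by move=> p /f0; rewrite lee_fin.
rewrite setDD (setIidr UD).
rewrite (@integral_open_mesh _ _ vx f (fun t p => hat x t j p * hat x t i p)).
- rewrite (eq_big_seq (fun t => (local_mass x t i j)%:E)) ?sumEFin// => t tT.
  by apply: integral_hat2; [exact: vx.1|exact: triangulation_uniq].
- move=> t p tT tp.
  have tp' : triangle x t p by apply: open_tri_sub tp; exact: vx.1.
  by rewrite /f !(nodalE vx _ tT tp').
- by move=> t; apply: measurable_funM; exact: measurable_hat.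
Qed.

End Valid.
End Assembly.

(** * Perturbation of a mesh *)

Section Perturbation.
Variables (R : realType).
Implicit Types (t : node * node * node).

Lemma cvg_fst_comp (I : Type) (F : set_system I) {FF : Filter F} (k : I -> R * R) (l : R * R) :
  k @ F --> l -> (k s).1 @[s --> F] --> l.1.
Proof. by case: l => l1 l2 kl; apply: (cvg_comp _ _ kl); exact: cvg_fst. Qed.

Lemma cvg_snd_comp (I : Type) (F : set_system I) {FF : Filter F} (k : I -> R * R) (l : R * R) :
  k @ F --> l -> (k s).2 @[s --> F] --> l.2.
Proof. by case: l => l1 l2 kl; apply: (cvg_comp _ _ kl); exact: cvg_snd. Qed.

Lemma cvg_area2 (I : Type) (F : set_system I) {FF : Filter F} (f g h : I -> R * R) (a b c : R * R) :
  f @ F --> a -> g @ F --> b -> h @ F --> c ->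
  area2 (f s) (g s) (h s) @[s --> F] --> area2 a b c.
Proof.
move=> fa gb hc.
have f1 := @cvg_fst_comp _ _ FF _ _ fa; have f2 := @cvg_snd_comp _ _ FF _ _ fa.
have g1 := @cvg_fst_comp _ _ FF _ _ gb; have g2 := @cvg_snd_comp _ _ FF _ _ gb.
have h1 := @cvg_fst_comp _ _ FF _ _ hc; have h2 := @cvg_snd_comp _ _ FF _ _ hc.
exact: (cvgB (cvgM (cvgB g1 f1) (cvgB h2 f2)) (cvgM (cvgB g2 f2) (cvgB h1 f1))).
Qed.

(** Validity amounts to finitely many strict inequalities continuous in the node positions, provided
    that the separating form of the limit mesh is kept fixed. *)
Lemma valid_mesh_near (I : Type) (F : set_system I) {FF : Filter F}
    (x : I -> node -> R * R) (y : node -> R * R) :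
  (forall i, x s i @[s --> F] --> y i) -> valid_mesh y ->
  \forall s \near F, valid_mesh (x s).
Proof.
move=> xy [Dy sepy].
have D : \forall s \near F, forall t, t \in triangulation -> 0 < tarea (x s) t.
  apply: filter_forall => t; have [tT|_] := boolP (t \in triangulation); last exact: nearW.
  have c : tarea (x s) t @[s --> F] --> tarea y t by apply: cvg_area2; exact: xy.
  by apply: (@filterS _ F FF _ _ _ (@cvgr_gt _ _ _ FF _ _ c 0 (Dy t tT))) => s D0 _.
have sep : \forall s \near F, forall t t', t \in triangulation ->
    t' \in triangulation -> t != t' -> ~~ share_edge t t' -> separated (x s) t t'.
  apply: filter_forall => t; apply: filter_forall => t'.
  have [tT|_] := boolP (t \in triangulation); last exact: nearW.
  have [t'T|_] := boolP (t' \in triangulation); last exact: nearW.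
  have [tt'|_] := boolP (t != t'); last exact: nearW.
  have [e|_] := boolP (~~ share_edge t t'); last exact: nearW.
  have [r [q rq]] := sepy t t' tT t'T tt' e.
  suff : \forall s \near F, forall i j, i \in verts t -> j \in verts t' -> i != j ->
      r * (x s j).1 + q * (x s j).2 < r * (x s i).1 + q * (x s i).2.
    by apply: filterS => s H _ _ _ _; exists r, q.
  apply: filter_forall => i; apply: filter_forall => j.
  have [it|_] := boolP (i \in verts t); last exact: nearW.
  have [jt|_] := boolP (j \in verts t'); last exact: nearW.
  have [ij|_] := boolP (i != j); last exact: nearW.
  have c k : r * (x s k).1 + q * (x s k).2 @[s --> F] --> r * (y k).1 + q * (y k).2.
    exact: (cvgD (cvgM (cvg_cst r) (@cvg_fst_comp _ _ FF _ _ (xy k)))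
      (cvgM (cvg_cst q) (@cvg_snd_comp _ _ FF _ _ (xy k)))).
  have /(_ FF) cij := cvgB (c i) (c j).
  have r0 : 0 < r * (y i).1 + q * (y i).2 - (r * (y j).1 + q * (y j).2).
    by rewrite subr_gt0 rq.
  near=> s => _ _ _; rewrite -subr_gt0; near: s.
  exact: (@cvgr_gt _ _ _ FF _ _ cij 0 r0).
near=> s; split; near: s.
  exact: D.
exact: sep.
Unshelve. all: by end_near. Qed.

Lemma derivable_fst_snd (f : R -> R * R) (a : R) : derivable f a 1 ->
  derivable (fun s => (f s).1) a 1 /\ derivable (fun s => (f s).2) a 1.
Proof.
move=> /cvg_ex[/= l fl]; split; apply/cvg_ex.
  by exists l.1; exact: (@cvg_fst_comp _ _ _ _ _ fl).
by exists l.2; exact: (@cvg_snd_comp _ _ _ _ _ fl).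
Qed.

Let dB (f g : R -> R) (a : R) : derivable f a 1 -> derivable g a 1 ->
  derivable (fun s => f s - g s) a 1.
Proof. exact: derivableB. Qed.

Let dD (f g : R -> R) (a : R) : derivable f a 1 -> derivable g a 1 ->
  derivable (fun s => f s + g s) a 1.
Proof. exact: derivableD. Qed.

Let dM (f g : R -> R) (a : R) : derivable f a 1 -> derivable g a 1 ->
  derivable (fun s => f s * g s) a 1.
Proof. exact: derivableM. Qed.

Section AtZero.
Variables (x : R -> node -> R * R).
Hypothesis x_derivable : forall i, derivable (x^~ i) 0 1.
Hypothesis valid0 : valid_mesh (x 0).

Let dx1 i : derivable (fun s => (x s i).1) 0 1.
Proof. by have [] := derivable_fst_snd (@x_derivable i). Qed.

Let dx2 i : derivable (fun s => (x s i).2) 0 1.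
Proof. by have [] := derivable_fst_snd (@x_derivable i). Qed.

Lemma valid_mesh_near0 : \forall s \near (0 : R), valid_mesh (x s).
Proof.
have cx i : x s i @[s --> (0 : R)] --> x 0 i.
  apply: (@differentiable_continuous _ _ _ (0 : R) (x^~ i)).
  exact/derivable1_diffP/x_derivable.
exact: (valid_mesh_near cx valid0).
Qed.

Let derivable_tarea t : derivable (fun s => tarea (x s) t) 0 1.
Proof.
exact: (dB (dM (dB (@dx1 _) (@dx1 _)) (dB (@dx2 _) (@dx2 _)))
  (dM (dB (@dx2 _) (@dx2 _)) (dB (@dx1 _) (@dx1 _)))).
Qed.

Let derivable_normal_at t i : derivable (fun s => (normal_at (x s) t i).1) 0 1 /\
  derivable (fun s => (normal_at (x s) t i).2) 0 1.
Proof.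
rewrite /normal_at /vertexwise /normal.
do 3 (case: (i == _) => /=; first by split; exact: dB).
by split; exact: derivable_cst.
Qed.

Lemma derivable_sum_seq (T : eqType) (s : seq T) (f : T -> R -> R) (a : R) :
  (forall k, k \in s -> derivable (f k) a 1) ->
  derivable (fun r => \sum_(k <- s) f k r) a 1.
Proof.
elim: s => [_|k s ih H].
  by under eq_fun do rewrite big_nil; exact: derivable_cst.
under eq_fun do rewrite big_cons.
apply: dD; first by apply: H; rewrite mem_head.
by apply: ih => u us; apply: H; rewrite inE us orbT.
Qed.

(** The entry agrees near [0] with the assembled sum, whose terms are rational in the coordinates
    with denominators [tarea], nonzero at [0]. *)
Lemma derivable_stiffness i j : derivable (fun s => stiffness (x s) i j) 0 1.
Proof.
apply: (@near_eq_derivable _ _ _ (fun s => \sum_(t <- triangulation) local_stiffness (x s) t i j)).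
  near=> s; rewrite stiffnessE//; near: s; exact: valid_mesh_near0.
apply: derivable_sum_seq => t tT.
have [di1 di2] := @derivable_normal_at t i; have [dj1 dj2] := @derivable_normal_at t j.
have dV : derivable (fun s => (tarea (x s) t)^-1) 0 1.
  apply: (@derivableV _ _ (fun s => tarea (x s) t)); last exact: derivable_tarea.
  exact/lt0r_neq0/valid0.1.
exact: (dM (dM (derivable_cst _ _ _) (dD (dM di1 dj1) (dM di2 dj2))) dV).
Unshelve. all: by end_near. Qed.

Lemma derivable_mass i j : derivable (fun s => mass (x s) i j) 0 1.
Proof.
apply: (@near_eq_derivable _ _ _ (fun s => \sum_(t <- triangulation) local_mass (x s) t i j)).
  near=> s; rewrite massE//; near: s; exact: valid_mesh_near0.
apply: derivable_sum_seq => t tT.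
by apply: dM => //; exact: derivable_cst.
Unshelve. all: by end_near. Qed.

End AtZero.

Lemma derivable_cvg_quotient (f : R -> R) : derivable f 0 1 ->
  (f s - f 0) / s @[s --> 0^'] --> derive1 f 0.
Proof.
move=> df; rewrite derive1E.
have : h^-1 *: (f (h *: 1 + 0) - f 0) @[h --> 0^'] --> 'D_1 f 0 by exact: df.
apply: cvg_trans; apply: near_eq_cvg; near=> s.
by rewrite /GRing.scale/= mulr1 addr0 mulrC.
Unshelve. all: by end_near. Qed.

End Perturbation.

(** * The hexagonal mesh *)

(* At e = sqrt 3 * d - 2 > 0, the entries (a, b) stand for a + b e, and the
   node (p, q) has hex_x = 2 p and hex_y = 2 sqrt 3 q. *)
Section HexagonCoordinates.
Local Open Scope int_scope.

Definition hex_x : seq (int * int) :=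
  [:: (0, 0); (2, 0); (1, 0); (-1, 0); (-2, 0); (-1, 0); (1, 0);
      (2, 1); (2, 1); (0, 0); (-2, -1); (-2, -1); (0, 0)].

Definition hex_y : seq (int * int) :=
  [:: (0, 0); (0, 0); (3, 0); (3, 0); (0, 0); (-3, 0); (-3, 0);
      (-2, -1); (2, 1); (4, 2); (2, 1); (-2, -1); (-4, -2)].

End HexagonCoordinates.

Definition hex_linear (rs : int * int) (m : nat) : int * int :=
  let X := nth (0, 0) hex_x m in let Y := nth (0, 0) hex_y m in
  (rs.1 * X.1 + rs.2 * Y.1, rs.1 * X.2 + rs.2 * Y.2).

(* (a, b, c) stands for the polynomial a + b e + c e^2. *)
Definition coef_pos (c : int * int * int) : bool :=
  [&& 0 <= c.1.1, 0 <= c.1.2, 0 <= c.2 & c != (0, 0, 0)].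

Definition separates (t t' : node * node * node) (rs : int * int) : bool :=
  all (fun i : node => all (fun j : node => (i == j) ||
    let a := hex_linear rs i in let b := hex_linear rs j in
    coef_pos (a.1 - b.1, a.2 - b.2, 0)) (verts t')) (verts t).

(** A search space of integer linear forms, large enough for every pair without a common edge; the
    form found works for all [e > 0] at once. *)
Definition directions : seq (int * int) :=
  let r := [:: 0; 1; 2; 3; -1; -2; -3] in [seq (a, b) | a <- r, b <- r].

(** Equal to [tarea] times [4 * sqrt 3], the product of the scalings 2 of [hex_x] and [2 * sqrt 3]
    of [hex_y]. *)
Definition hex_area (t : node * node * node) : int * int * int :=
  let X (m : node) := nth (0, 0) hex_x m in let Y (m : node) := nth (0, 0) hex_y m in
  let sub (a b : int * int) := (a.1 - b.1, a.2 - b.2) in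
  let mul (a b : int * int) := (a.1 * b.1, a.1 * b.2 + a.2 * b.1, a.2 * b.2) in
  let a := mul (sub (X t.1.2) (X t.1.1)) (sub (Y t.2) (Y t.1.1)) in
  let b := mul (sub (Y t.1.2) (Y t.1.1)) (sub (X t.2) (X t.1.1)) in
  (a.1.1 - b.1.1, a.1.2 - b.1.2, a.2 - b.2).

Lemma hex_separated_check : all (fun t => all (fun t' =>
  [|| t == t', share_edge t t' | has (separates t t') directions])
  triangulation) triangulation.
Proof. by vm_compute. Qed.

Lemma hex_area_check : all (fun t => coef_pos (hex_area t)) triangulation.
Proof. by vm_compute. Qed.

Section Hexagon.
Variable R : realType.

(** The triple angle formula at [pi] reads [4 c^3 - 3 c + 1 = 0], which factors as
    [(c + 1) (2 c - 1)^2 = 0], and [c] is positive. *)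
Lemma cos_pi3 : cos (pi / 3) = 1 / 2 :> R.
Proof.
have pi0 := pi_gt0 R.
have c0 : 0 < cos (pi / 3 : R) by apply: cos_gt0_pihalf; lra.
have : cos (pi / 3 + pi / 3 + pi / 3 : R) = -1.
  by rewrite (_ : _ + _ = pi); [exact: cospi|field].
rewrite !cosD sinD => e.
have s2 : sin (pi / 3 : R) ^+ 2 = 1 - cos (pi / 3) ^+ 2 by rewrite sin2cos2.
set c := cos _ in c0 e s2 *; set s := sin _ in e s2 *.
have e' : c * c ^+ 2 - 3 * c * s ^+ 2 = -1 by rewrite -e; ring.
have : (c + 1) * (2 * c - 1) ^+ 2 = 0.
  transitivity (c * c ^+ 2 - 3 * c * (1 - c ^+ 2) + 1); first by ring.
  by rewrite -s2 e'; ring.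
move=> /eqP; rewrite mulf_eq0 expf_eq0/= => /orP[/eqP|/eqP]; lra.
Qed.

Lemma sin_pi3 : sin (pi / 3) = Num.sqrt 3 / 2 :> R.
Proof.
have pi0 := pi_gt0 R.
have s0 : 0 < sin (pi / 3 : R) by apply: sin_gt0_pi; lra.
rewrite -[LHS]gtr0_norm// -sqrtr_sqr sin2cos2 cos_pi3.
have -> : 1 - (1 / 2) ^+ 2 = 3 / 2 ^+ 2 :> R by field.
by rewrite sqrtrM ?ler0n// sqrtrV ?sqr_ge0// sqrtr_sqr ger0_norm.
Qed.

Lemma sqrt3_sqr : Num.sqrt 3 * Num.sqrt 3 = 3 :> R.
Proof. by rewrite -expr2 sqr_sqrtr. Qed.

(** Rotation by [pi / 3] in the coordinates [2 p] and [2 sqrt 3 q], chosen because it becomes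
    rational there. *)
Definition rotate_sixth (v : R * R) : R * R := ((v.1 - v.2) / 2, (v.2 + 3 * v.1) / 2).

Definition scaled_direction (a : R) : R * R := (2 * cos a, 2 * Num.sqrt 3 * sin a).

Lemma scaled_directionD a k :
  scaled_direction (a + k%:R * (pi / 3)) = iter k rotate_sixth (scaled_direction a).
Proof.
elim: k => [|k ih]; first by rewrite mul0r addr0.
rewrite iterS -ih -natr1 mulrDl mul1r addrA /scaled_direction /rotate_sixth/=.
move: (a + k%:R * (pi / 3)) => b; rewrite cosD sinD cos_pi3 sin_pi3.
have s3 := sqrt3_sqr; congr (_, _).
  by field.
have -> : 2 * Num.sqrt 3 * (sin b * (1 / 2) + cos b * (Num.sqrt 3 / 2)) =
  Num.sqrt 3 * sin b + cos b * (Num.sqrt 3 * Num.sqrt 3) :> R by field.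
by rewrite s3; field.
Qed.

Definition eval_coef (e : R) (c : int * int) : R := c.1%:~R + c.2%:~R * e.

Lemma hexagon_coords d (i : node) : let e := Num.sqrt 3 * d - 2 in
  2 * (hexagon d i).1 = eval_coef e (nth (0, 0) hex_x i) /\
  2 * Num.sqrt 3 * (hexagon d i).2 = eval_coef e (nth (0, 0) hex_y i).
Proof.
move=> e; have s3 := sqrt3_sqr.
have de : Num.sqrt 3 * d = e + 2 by rewrite /e; ring.
rewrite /hexagon; case: fintype.splitP => [i' ->|k ->].
  case: unliftP => [j ->|->]; last by rewrite /eval_coef/= !mulr0 mul0r addr0.
  have -> : j%:R * pi / 3 = 0 + j%:R * (pi / 3) :> R by rewrite add0r mulrA.
  have := scaled_directionD 0 j.
  rewrite [X in iter _ _ X]/scaled_direction cos0 sin0 mulr0 mulr1.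
  move=> /[dup] /(congr1 fst)/= -> /(congr1 snd)/= ->; rewrite ?lift0.
  case: j => [[|[|[|[|[|[|//]]]]]] ?] /=; rewrite /rotate_sixth /eval_coef/=; split; lra.
(* The outer ring starts at angle [- pi / 6], with scaled direction [(sqrt 3, - sqrt 3)]; multiplied
   by [d] its entries are [e + 2] and [- (e + 2)]. *)
have := scaled_directionD (- (pi / 6)) k.
have c6 : 2 * cos (- (pi / 6)) = Num.sqrt 3 :> R.
  rewrite cosN (_ : pi / 6 = pi / 2 - pi / 3) ?cosB; last by field.
  by rewrite cos_pihalf sin_pihalf sin_pi3; field.
have s6 : 2 * sin (- (pi / 6)) = - 1 :> R.
  rewrite sinN (_ : pi / 6 = pi / 2 - pi / 3) ?sinB; last by field.
  by rewrite cos_pihalf sin_pihalf cos_pi3; field.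
have -> : - (pi / 6) + k%:R * (pi / 3) = (2 * k%:R - 1) * pi / 6 :> R by field.
rewrite [X in iter _ _ X]/scaled_direction c6 (mulrAC 2 _ (sin _)) s6 mulN1r.
move=> /[dup] /(congr1 fst)/= E1 /(congr1 snd)/= E2.
rewrite /= mulrCA E1 mulrCA E2 => {E1 E2}.
case: k => [[|[|[|[|[|[|//]]]]]] ?] /=; rewrite /rotate_sixth /eval_coef/=; split; lra.
Qed.

Definition eval_coef2 (e : R) (c : int * int * int) : R :=
  c.1.1%:~R + c.1.2%:~R * e + c.2%:~R * e ^+ 2.

Lemma coef_pos_eval (e : R) (c : int * int * int) : 0 < e -> coef_pos c ->
  0 < eval_coef2 e c.
Proof.
case: c => [[a b] c] e0 /and4P[/= a0 b0 c0]; rewrite !xpair_eqE /eval_coef2/= => n0.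
have A : 0 <= a%:~R :> R by rewrite ler0z.
have B : 0 <= b%:~R * e by rewrite mulr_ge0 ?ler0z// ltW.
have C : 0 <= c%:~R * e ^+ 2 by rewrite mulr_ge0 ?ler0z// exprn_ge0// ltW.
have [az|az] := eqVneq a 0; last first.
  have : 0 < a%:~R :> R by rewrite ltr0z lt_def az.
  by lra.
have [bz|bz] := eqVneq b 0; last first.
  have : 0 < b%:~R * e by rewrite mulr_gt0// ltr0z lt_def bz.
  by lra.
have : 0 < c%:~R * e ^+ 2.
  rewrite mulr_gt0 ?exprn_gt0// ltr0z lt_def c0 andbT.
  by move: n0; rewrite az bz !eqxx.
by lra.
Qed.

Lemma tarea_hexagon d t : let e := Num.sqrt 3 * d - 2 in
  eval_coef2 e (hex_area t) = (4 * Num.sqrt 3) * tarea (hexagon d) t.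
Proof.
move=> e; have X i := (hexagon_coords d i).1; have Y i := (hexagon_coords d i).2.
rewrite -/e in X Y; transitivity ((2 * (hexagon d t.1.2).1 - 2 * (hexagon d t.1.1).1) *
    (2 * Num.sqrt 3 * (hexagon d t.2).2 - 2 * Num.sqrt 3 * (hexagon d t.1.1).2) -
    (2 * Num.sqrt 3 * (hexagon d t.1.2).2 - 2 * Num.sqrt 3 * (hexagon d t.1.1).2) *
    (2 * (hexagon d t.2).1 - 2 * (hexagon d t.1.1).1)); last first.
  by rewrite /tarea /area2; ring.
rewrite !X !Y /eval_coef /eval_coef2 /hex_area/=.
by rewrite !rmorphB/= !rmorphD/= !rmorphM/= !rmorphB/=; ring.
Qed.

Lemma hexagon_param_gt0 (d : R) : 2 / Num.sqrt 3 < d -> 0 < Num.sqrt 3 * d - 2.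
Proof. by rewrite ltr_pdivrMr ?sqrtr_gt0// subr_gt0 mulrC. Qed.

Lemma valid_hexagon (d : R) : 2 / Num.sqrt 3 < d -> valid_mesh (hexagon d).
Proof.
move=> dgt; pose e := Num.sqrt 3 * d - 2.
have s0 : 0 < Num.sqrt 3 :> R by rewrite sqrtr_gt0.
have e0 : 0 < e := hexagon_param_gt0 dgt.
have X i := (hexagon_coords d i).1; have Y i := (hexagon_coords d i).2.
rewrite -/e in X Y.
split=> [t tT|t t' tT t'T tt' nsh].
  have /allP/(_ t tT)/(coef_pos_eval e0) := hex_area_check.
  by rewrite tarea_hexagon pmulr_rgt0// mulr_gt0.
have /allP/(_ t tT)/allP/(_ t' t'T) := hex_separated_check.
rewrite (negbTE tt') (negbTE nsh) !orFb; case/hasP => -[r s] _ /allP sep.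
(* The factors turn a form in the scaled coordinates [hex_x], [hex_y] into one in the true
   coordinates. *)
exists (r%:~R * 2), (s%:~R * (2 * Num.sqrt 3)) => i j it jt ij.
have /allP/(_ j jt) := sep i it; rewrite (negbTE ij)/= => /(coef_pos_eval e0)/=.
rewrite /eval_coef2/= mul0r addr0 -!mulrA !(mulrA 2) !X !Y /eval_coef.
by rewrite !rmorphB/= !rmorphD/= !rmorphM/=; lra.
Qed.

End Hexagon.

(** * Perturbation of matrix pencils *)

Section Pencil.
Variables (R : realType) (I : Type) (F : set_system I).
Context {FF : Filter F}.
Variables m n : nat.
Implicit Types (P Q : I -> 'M[R]_(m, n)) (A B : 'M[R]_(m, n)).

(** At each [(l, v)] some row of the limit residual is nonzero, and it stays so for nearby
    [(l', v')] and for eventual [s] simultaneously; compactness makes the choice of [s] uniform. A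
    nonzero [u] is normalized at the end. *)
Lemma bounded_pencil_injective_near P Q A B :
  (forall i j, P s i j @[s --> F] --> A i j) ->
  (forall i j, Q s i j @[s --> F] --> B i j) ->
  (forall (l : R) (u : 'cV_n), A *m u = l *: (B *m u) -> u = 0) ->
  \forall s \near F, forall (l : R) (u : 'cV_n), `|l| <= 1 ->
    P s *m u = l *: (Q s *m u) -> u = 0.
Proof.
move=> PA QB inj.
pose S := [set v : 'rV[R]_n | `|v| = 1].
have cS : compact S.
  apply: bounded_closed_compact.
    by exists 1; split => // r r1 v /= ->; exact: ltW.
  have /continuous_closedP/(_ [set r | r = 1]) := @norm_continuous R 'rV[R]_n.
  by apply; exact: closed_eq.
pose K := [set` `[(-1 : R), 1]] `*` S.
have cK : compact K by apply: compact_setX => //; exact: segment_compact.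
pose h (M N : 'M[R]_(m, n)) (z : R * 'rV[R]_n) i :=
  \sum_j (M i j - z.1 * N i j) * z.2 0 j.
have hE M N l (v : 'rV[R]_n) i :
    h M N (l, v) i = (M *m v^T - l *: (N *m v^T)) i 0.
  rewrite /h !mxE mulr_sumr -sumrB; apply: eq_bigr => j _.
  by rewrite !mxE/=; ring.
have near_h z : K z -> \forall z' \near z & s \near F,
    ~ (forall i, h (P s) (Q s) z' i = 0).
  move: z => [l v] [/= _ v1].
  have [i hi] : exists i, h A B (l, v) i != 0.
    apply: contrapT => H; have v0 : v^T = 0.
      apply: (inj l); apply/eqP; rewrite -subr_eq0; apply/eqP/matrixP => i j.
      rewrite (ord1 j) [RHS]mxE -hE; apply/eqP/negPn/negP => hi.
      by apply: H; exists i.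
    by move: v1; rewrite /S/= -[v]trmxK v0 trmx0 normr0 => /eqP; rewrite eq_sym oner_eq0.
  have : (fun zs : (R * 'rV[R]_n) * I => h (P zs.2) (Q zs.2) zs.1 i) @
      filter_prod (nbhs (l, v)) F --> h A B (l, v) i.
    apply: cvg_big => // [|j _]; first exact: add_continuous.
    have cz1 : (fun zs : (R * 'rV[R]_n) * I => zs.1.1) @ filter_prod (nbhs (l, v)) F --> l.
      by apply: (cvg_comp fst fst); [exact: cvg_fst|exact: cvg_fst].
    have cz2 : (fun zs : (R * 'rV[R]_n) * I => zs.1.2 0 j) @ filter_prod (nbhs (l, v)) F --> v 0 j.
      apply: (cvg_comp fst (fun z : R * 'rV[R]_n => z.2 0 j)); first exact: cvg_fst.
      apply: (cvg_comp snd (fun w : 'rV[R]_n => w 0 j)); first exact: cvg_snd.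
      exact: coord_continuous.
    have cP : (fun zs : (R * 'rV[R]_n) * I => P zs.2 i j) @ filter_prod (nbhs (l, v)) F --> A i j.
      by apply: (cvg_comp snd (fun s => P s i j)); [exact: cvg_snd|exact: PA].
    have cQ : (fun zs : (R * 'rV[R]_n) * I => Q zs.2 i j) @ filter_prod (nbhs (l, v)) F --> B i j.
      by apply: (cvg_comp snd (fun s => Q s i j)); [exact: cvg_snd|exact: QB].
    by apply: cvgM => //; apply: cvgB => //; exact: cvgM.
  move=> /cvgr_neq0/(_ hi); apply: filterS => -[z' s] /= /eqP hz' H.
  exact/hz'/H.
have /compact_near_coveringP := cK.
move=> /(_ I F (fun s z => ~ (forall i, h (P s) (Q s) z i = 0)) FF near_h).
apply: filterS => s HK l u l1 e; apply: contrapT => /eqP u0.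
have nu : `|u^T| != 0.
  by rewrite normr_eq0; apply: contra u0 => /eqP u0; rewrite -[u]trmxK u0 trmx0.
apply: (HK (l, `|u^T|^-1 *: u^T)).
  split => /=; first by rewrite in_itv/= -ler_norml.
  by rewrite /S/= normrZ normfV normr_id mulVf.
move=> i; rewrite hE linearZ/= trmxK -!scalemxAr scalerA mulrC -scalerA -scalerBr.
by rewrite e subrr scaler0 mxE.
Qed.

(** For [|l| > 1] the equation is read as [Q u = l^-1 P u], whose parameter is bounded again. The
    second injectivity hypothesis is the chart at infinity of the limit pencil. *)
Lemma pencil_injective_near P Q A B :
  (forall i j, P s i j @[s --> F] --> A i j) ->
  (forall i j, Q s i j @[s --> F] --> B i j) ->
  (forall (l : R) (u : 'cV_n), A *m u = l *: (B *m u) -> u = 0) ->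
  (forall (l : R) (u : 'cV_n), B *m u = l *: (A *m u) -> u = 0) ->
  \forall s \near F, forall (l : R) (u : 'cV_n),
    P s *m u = l *: (Q s *m u) -> u = 0.
Proof.
move=> PA QB injA injB.
have := bounded_pencil_injective_near PA QB injA.
apply: filter_app; have := bounded_pencil_injective_near QB PA injB.
apply: filterS => s HB HA l u e.
have [l1|l1] := leP `|l| 1; first exact: HA e.
have l0 : l != 0 by rewrite -normr_gt0 (lt_trans _ l1).
apply: (HB l^-1); first by rewrite normfV invf_le1 ?ltW// normr_gt0.
by rewrite e scalerA mulVf// scale1r.
Qed.

End Pencil.

(** * Rows of the matrices of the hexagonal mesh *)

(** With the next two definitions, the three orbits of triangles under rotation by [pi / 3]. The
    tables below refer to a vertex by its position 0, 1, 2 in the triple. *)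
Definition center_tri j := (Defs.center, inner j, inner j.+1).
Definition middle_tri j := (inner j, outer j.+1, inner j.+1).
Definition outer_tri j := (outer j, outer j.+1, inner j).

Lemma inner_periodic j : inner (6 + j) = inner j.
Proof.
rewrite /inner /cyc6; congr (lshift _ (lift _ _)); apply: val_inj.
by rewrite /= modnDl.
Qed.

Ltac decide_node_eqs := repeat match goal with
  |- context [@eq_op ?T ?a ?b] =>
    let r := eval vm_compute in (@eq_op T a b) in
    match r with true => idtac | false => idtac end;
    change (@eq_op T a b) with r; cbv iota
  end.

Section LocalTables.
Variable R : realType.
Implicit Types (t : node * node * node).

Definition table_form (l : nat -> nat -> R) t (i j : node) : R :=
  vertexwise 0 t
    (vertexwise 0 t (l 0%N 0%N) (l 0%N 1%N) (l 0%N 2%N) j)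
    (vertexwise 0 t (l 1%N 0%N) (l 1%N 1%N) (l 1%N 2%N) j)
    (vertexwise 0 t (l 2%N 0%N) (l 2%N 1%N) (l 2%N 2%N) j) i.

Lemma sum_table_form l t i (U : node -> R) : uniq (verts t) ->
  \sum_j table_form l t i j * U j = vertexwise 0 t
    (l 0%N 0%N * U t.1.1 + l 0%N 1%N * U t.1.2 + l 0%N 2%N * U t.2)
    (l 1%N 0%N * U t.1.1 + l 1%N 1%N * U t.1.2 + l 1%N 2%N * U t.2)
    (l 2%N 0%N * U t.1.1 + l 2%N 1%N * U t.1.2 + l 2%N 2%N * U t.2) i.
Proof.
move=> ut; rewrite /table_form [in RHS]/vertexwise.
under eq_bigr => j _ do rewrite [vertexwise _ _ _ _ _ i]/vertexwise.
do 3 (case: (i == _); first exact: sum_vertexwise).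
by rewrite big1// => j _; rewrite mul0r.
Qed.

(** The letters [p], [q], [r] stand for center, middle and outer triangles; the digits for the pairs
    center-center (0), center-inner (1), equal inner nodes (2), neighbouring inner nodes (3),
    inner-outer (4). An inner node lies in two center, two middle and one outer triangle, whence the
    coefficients. [j + 5] is the predecessor of [j] modulo 6. *)
Lemma hex_rows (l : node * node * node -> nat -> nat -> R)
    (p0 p1 p2 p3 q2 q3 q4 r2 r4 : R) (U : node -> R) :
  (forall j, (j < 6)%N -> [/\ l (center_tri j) 0%N 0%N = p0,
     [/\ l (center_tri j) 0%N 1%N = p1, l (center_tri j) 0%N 2%N = p1,
         l (center_tri j) 1%N 0%N = p1 & l (center_tri j) 2%N 0%N = p1],
     [/\ l (center_tri j) 1%N 1%N = p2 & l (center_tri j) 2%N 2%N = p2] &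
     [/\ l (center_tri j) 1%N 2%N = p3 & l (center_tri j) 2%N 1%N = p3]]) ->
  (forall j, (j < 6)%N -> [/\
     [/\ l (middle_tri j) 0%N 0%N = q2 & l (middle_tri j) 2%N 2%N = q2],
     [/\ l (middle_tri j) 0%N 2%N = q3 & l (middle_tri j) 2%N 0%N = q3] &
     [/\ l (middle_tri j) 1%N 0%N = q4 & l (middle_tri j) 1%N 2%N = q4]]) ->
  (forall j, (j < 6)%N -> [/\ l (outer_tri j) 2%N 2%N = r2,
     l (outer_tri j) 0%N 2%N = r4 & l (outer_tri j) 1%N 2%N = r4]) ->
  (forall k, U (outer k) = 0) ->
  let row i := \sum_(t <- triangulation) \sum_j table_form (l t) t i j * U j in
  [/\ row Defs.center = 6 * p0 * U Defs.center + 2 * p1 * \sum_(0 <= j < 6) U (inner j),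
      forall j, (j < 6)%N -> row (inner j) = 2 * p1 * U Defs.center +
        (2 * p2 + 2 * q2 + r2) * U (inner j) + (p3 + q3) * (U (inner (j + 5)) + U (inner j.+1))
    & forall k, (k < 6)%N -> row (outer k) = (q4 + r4) * (U (inner (k + 5)) + U (inner k))].
Proof.
move=> Hc Hm Ho U0 row.
have rowE i : row i =
    \sum_(0 <= j < 6) vertexwise 0 (center_tri j)
      (p0 * U Defs.center + p1 * U (inner j) + p1 * U (inner j.+1))
      (p1 * U Defs.center + p2 * U (inner j) + p3 * U (inner j.+1))
      (p1 * U Defs.center + p3 * U (inner j) + p2 * U (inner j.+1)) i +
    (\sum_(0 <= j < 6) vertexwise 0 (middle_tri j)
      (q2 * U (inner j) + q3 * U (inner j.+1))
      (q4 * U (inner j) + q4 * U (inner j.+1))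
      (q3 * U (inner j) + q2 * U (inner j.+1)) i +
    \sum_(0 <= j < 6) vertexwise 0 (outer_tri j)
      (r4 * U (inner j)) (r4 * U (inner j)) (r2 * U (inner j)) i).
  rewrite /row /triangulation 2!big_cat 3!big_map; congr (_ + (_ + _));
    apply: eq_big_seq => j; rewrite mem_iota/= => j6.
  - have tT : center_tri j \in triangulation.
      by rewrite mem_cat; apply/orP; left; apply/mapP; exists j; rewrite ?mem_iota.
    rewrite sum_table_form ?(triangulation_uniq tT)//=.
    by have [-> [-> -> -> ->] [-> ->] [-> ->]] := Hc j j6.
  - have tT : middle_tri j \in triangulation.
      rewrite !mem_cat; apply/orP; right; apply/orP; left.
      by apply/mapP; exists j; rewrite ?mem_iota.
    rewrite sum_table_form ?(triangulation_uniq tT)//= !U0 !mulr0 !addr0.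
    by have [[-> ->] [-> ->] [-> ->]] := Hm j j6.
  - have tT : outer_tri j \in triangulation.
      rewrite !mem_cat; apply/orP; right; apply/orP; right.
      by apply/mapP; exists j; rewrite ?mem_iota.
    rewrite sum_table_form ?(triangulation_uniq tT)//= !U0 !mulr0 !add0r.
    by have [-> -> ->] := Ho j j6.
have e6 := inner_periodic 0; have e7 := inner_periodic 1.
have e8 := inner_periodic 2; have e9 := inner_periodic 3; have e10 := inner_periodic 4.
rewrite /= in e6 e7 e8 e9 e10.
have sum6 (f : nat -> R) : \sum_(0 <= j < 6) f j = f 0%N + f 1%N + f 2%N + f 3%N + f 4%N + f 5%N.
  by rewrite unlock /=; ring.
split.
- rewrite rowE !sum6 /vertexwise /center_tri /middle_tri /outer_tri; cbv [fst snd].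
  decide_node_eqs; rewrite e6; ring.
- do 6 (case; first by move=> _; rewrite rowE !sum6 /vertexwise /center_tri /middle_tri /outer_tri;
    cbv [fst snd]; decide_node_eqs; rewrite /= ?e6 ?e7 ?e8 ?e9 ?e10; ring).
  by [].
- do 6 (case; first by move=> _; rewrite rowE !sum6 /vertexwise /center_tri /middle_tri /outer_tri;
    cbv [fst snd]; decide_node_eqs; rewrite /= ?e6 ?e7 ?e8 ?e9 ?e10; ring).
  by [].
Qed.

End LocalTables.

Definition hex_normal (t : node * node * node) (a : nat) : (int * int) * (int * int) :=
  let X (m : node) := nth (0, 0) hex_x m in let Y (m : node) := nth (0, 0) hex_y m in
  let sub (a b : int * int) := (a.1 - b.1, a.2 - b.2) in
  let n (b c : node) := (sub (Y b) (Y c), sub (X c) (X b)) in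
  match a with
  | 0%N => n t.1.2 t.2
  | 1%N => n t.2 t.1.1
  | _ => n t.1.1 t.1.2
  end.

(* 12 times the dot product of two normals: the normals have coordinates
   hex_normal.1 / (2 sqrt 3) and hex_normal.2 / 2. *)
Definition hex_dot (t : node * node * node) (a b : nat) : int * int * int :=
  let mul (a b : int * int) := (a.1 * b.1, a.1 * b.2 + a.2 * b.1, a.2 * b.2) in
  let u := mul (hex_normal t a).1 (hex_normal t b).1 in
  let v := mul (hex_normal t a).2 (hex_normal t b).2 in
  (u.1.1 + v.1.1 *+ 3, u.1.2 + v.1.2 *+ 3, u.2 + v.2 *+ 3).

Definition positions : seq (nat * nat) := [seq (a, b) | a <- iota 0 3, b <- iota 0 3].

Definition family_data (f : nat -> node * node * node) (j : nat) :=
  (hex_area (f j), [seq hex_dot (f j) ab.1 ab.2 | ab <- positions]).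

(** Rotation invariance as equality of integer data: the coordinates change with [j], but areas and
    products of normals are the same polynomials in [e]. *)
Lemma family_data_cst (f : nat -> node * node * node) :
  f = center_tri \/ f = middle_tri \/ f = outer_tri ->
  forall j, (j < 6)%N -> family_data f j = family_data f 0.
Proof.
move=> H j j6; apply/eqP; have : j \in iota 0 6 by rewrite mem_iota.
move: j {j6}; apply/allP; move: H => [->|[->|->]]; by vm_compute.
Qed.

Section HexagonMatrices.
Variable R : realType.
Implicit Types (x : node -> R * R) (t : node * node * node).

Definition position_normal x t (a : nat) : R * R :=
  match a with
  | 0%N => normal (x t.1.2) (x t.2)
  | 1%N => normal (x t.2) (x t.1.1)
  | _ => normal (x t.1.1) (x t.1.2)
  end.

Definition stiffness_table x t (a b : nat) : R :=
  kappa_area R * dot (position_normal x t a) (position_normal x t b) / tarea x t.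

Definition mass_table x t (a b : nat) : R :=
  tarea x t * (if a == b then kappa_diag R else kappa_off R).

Lemma local_stiffness_table x t i j :
  local_stiffness x t i j = table_form (stiffness_table x t) t i j.
Proof.
rewrite /local_stiffness /table_form /normal_at /vertexwise /stiffness_table.
by do 3 (case: (i == _); first by do 3 (case: (j == _) => //=);
  rewrite /dot/= !mulr0 !addr0 mulr0 mul0r);
  rewrite /dot/= !mul0r !addr0 mulr0 mul0r.
Qed.

Lemma local_mass_table x t i j : uniq (verts t) ->
  local_mass x t i j = table_form (mass_table x t) t i j.
Proof.
case: t => [[a b] c]; rewrite /= !inE negb_or andbT => /andP[/andP[ab ac] bc].
rewrite /local_mass /table_form /vertexwise /mass_table !inE/=.
have ba : b == a = false by rewrite eq_sym (negbTE ab).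
have ca : c == a = false by rewrite eq_sym (negbTE ac).
have cb : c == b = false by rewrite eq_sym (negbTE bc).
have E := (negbTE ab, negbTE ac, negbTE bc, ba, ca, cb, eqxx).
have [->|ia] := eqVneq i a; [|have [->|ib] := eqVneq i b;
  [|have [->|ic] := eqVneq i c; last by rewrite mulr0]];
  (have [ej|ja] := eqVneq j a; [|have [ej|jb] := eqVneq j b;
    [|have [ej|jc] := eqVneq j c]]); rewrite ?ej ?E ?mulr0//= ?E//.
Qed.

Section AtHexagon.
Variables (d : R) (d_gt : 2 / Num.sqrt 3 < d).
Let e : R := Num.sqrt 3 * d - 2.
Let e0 : 0 < e. Proof. exact: hexagon_param_gt0. Qed.
Let s0 : 0 < Num.sqrt 3 :> R. Proof. by rewrite sqrtr_gt0. Qed.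

Lemma dot_hexagon t a b : eval_coef2 e (hex_dot t a b) =
  12 * dot (position_normal (hexagon d) t a) (position_normal (hexagon d) t b).
Proof.
have X i := (hexagon_coords d i).1; have Y i := (hexagon_coords d i).2.
rewrite -/e in X Y.
pose ev2 (v : (int * int) * (int * int)) : R * R := (eval_coef e v.1, eval_coef e v.2).
have N c : ev2 (hex_normal t c) =
    (2 * Num.sqrt 3 * (position_normal (hexagon d) t c).1,
     2 * (position_normal (hexagon d) t c).2).
  rewrite /ev2; case: c => [|[|c]] /=; rewrite 2!mulrBr !X !Y /eval_coef/= !rmorphB/=;
    congr (_, _); ring.
have [N1 N2] : eval_coef e (hex_normal t a).1 = 2 * Num.sqrt 3 * (position_normal (hexagon d) t a).1
  /\ eval_coef e (hex_normal t a).2 = 2 * (position_normal (hexagon d) t a).2.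
  by have [-> ->] := N a.
have [N3 N4] : eval_coef e (hex_normal t b).1 = 2 * Num.sqrt 3 * (position_normal (hexagon d) t b).1
  /\ eval_coef e (hex_normal t b).2 = 2 * (position_normal (hexagon d) t b).2.
  by have [-> ->] := N b.
transitivity (eval_coef e (hex_normal t a).1 * eval_coef e (hex_normal t b).1 +
  3 * (eval_coef e (hex_normal t a).2 * eval_coef e (hex_normal t b).2)).
  rewrite /hex_dot /eval_coef2 /eval_coef/=.
  by ring.
rewrite N1 N2 N3 N4 /dot.
have -> : 2 * Num.sqrt 3 * (position_normal (hexagon d) t a).1 *
  (2 * Num.sqrt 3 * (position_normal (hexagon d) t b).1) =
  4 * (Num.sqrt 3 * Num.sqrt 3) * ((position_normal (hexagon d) t a).1 *
    (position_normal (hexagon d) t b).1) :> R by ring.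
by rewrite sqrt3_sqr; ring.
Qed.

Lemma stiffness_table_hexagon t a b : stiffness_table (hexagon d) t a b =
  kappa_area R * (eval_coef2 e (hex_dot t a b) / 12) /
    (eval_coef2 e (hex_area t) / (4 * Num.sqrt 3)).
Proof.
rewrite dot_hexagon /e tarea_hexagon /stiffness_table; congr (_ * _ / _).
  by field.
by rewrite mulrAC divff ?mul1r// mulf_neq0// lt0r_neq0.
Qed.

Section Family.
Variables (f : nat -> node * node * node).
Hypothesis f_family : f = center_tri \/ f = middle_tri \/ f = outer_tri.

Lemma tarea_family j : (j < 6)%N -> tarea (hexagon d) (f j) = tarea (hexagon d) (f 0%N).
Proof.
move=> /(family_data_cst f_family)/(congr1 fst)/= E.
have n0 : 4 * Num.sqrt 3 != 0 :> R by rewrite mulf_neq0// lt0r_neq0.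
by apply: (mulfI n0); rewrite -!tarea_hexagon E.
Qed.

Lemma stiffness_table_family j a b : (j < 6)%N -> (a < 3)%N -> (b < 3)%N ->
  stiffness_table (hexagon d) (f j) a b = stiffness_table (hexagon d) (f 0%N) a b.
Proof.
move=> j6 a3 b3; rewrite !stiffness_table_hexagon.
have /(congr1 fst)/= -> := family_data_cst f_family j6.
have E : [seq hex_dot (f j) ab.1 ab.2 | ab <- positions] =
    [seq hex_dot (f 0%N) ab.1 ab.2 | ab <- positions].
  exact: (congr1 snd (family_data_cst f_family j6)).
suff -> : hex_dot (f j) a b = hex_dot (f 0%N) a b by [].
have /eq_in_map/(_ (a, b)) := E; apply.
by apply/allpairsP; exists (a, b); rewrite !mem_iota.
Qed.

End Family.

(** The shape shared by both matrices of the regular mesh, recorded by their action on vectors that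
    vanish on the boundary, so that only the columns of interior nodes enter. *)
Definition hex_matrix (S : node -> node -> R) (p0 p1 s2 s3 b : R) : Prop :=
  forall U : node -> R, (forall k, U (outer k) = 0) ->
  [/\ \sum_v S Defs.center v * U v = p0 * U Defs.center + p1 * \sum_(0 <= j < 6) U (inner j),
      forall j, (j < 6)%N -> \sum_v S (inner j) v * U v =
        p1 * U Defs.center + s2 * U (inner j) + s3 * (U (inner (j + 5)) + U (inner j.+1))
    & forall k, (k < 6)%N -> \sum_v S (outer k) v * U v = b * (U (inner (k + 5)) + U (inner k))].

Lemma sum_assembled (S : node -> node -> R) (L : node * node * node -> node -> node -> R) :
  (forall i j, S i j = \sum_(t <- triangulation) L t i j) ->
  forall i U, \sum_v S i v * U v = \sum_(t <- triangulation) \sum_v L t i v * U v.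
Proof.
move=> SL i U; under eq_bigr => v _ do rewrite SL mulr_suml.
exact: exchange_big.
Qed.

Let vx := valid_hexagon d_gt.

Let Cf : center_tri = center_tri \/ center_tri = middle_tri \/ center_tri = outer_tri.
Proof. by left. Qed.
Let Mf : middle_tri = center_tri \/ middle_tri = middle_tri \/ middle_tri = outer_tri.
Proof. by right; left. Qed.
Let Of : outer_tri = center_tri \/ outer_tri = middle_tri \/ outer_tri = outer_tri.
Proof. by right; right. Qed.

Let area_gt0 t : coef_pos (hex_area t) -> 0 < eval_coef2 e (hex_area t) / (4 * Num.sqrt 3).
Proof. by move=> /(coef_pos_eval e0) h; rewrite divr_gt0// mulr_gt0. Qed.

Let stiffness_table_gt0 t a b : coef_pos (hex_area t) -> coef_pos (hex_dot t a b) ->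
  0 < stiffness_table (hexagon d) t a b.
Proof.
move=> /area_gt0 h /(coef_pos_eval e0) h'; rewrite stiffness_table_hexagon.
by rewrite divr_gt0// mulr_gt0 ?divr_gt0// (kappa_areaP R).2.
Qed.

Let neg_coef (c : int * int * int) : int * int * int := (- c.1.1, - c.1.2, - c.2).

Let stiffness_table_lt0 t a b : coef_pos (hex_area t) -> coef_pos (neg_coef (hex_dot t a b)) ->
  stiffness_table (hexagon d) t a b < 0.
Proof.
move=> /area_gt0 h /(coef_pos_eval e0) h'; rewrite stiffness_table_hexagon.
rewrite -oppr_gt0 -mulNr -mulrN -mulNr divr_gt0// mulr_gt0 ?divr_gt0//.
  exact: (kappa_areaP R).2.
by move: h'; rewrite /eval_coef2 /neg_coef/= !rmorphN/=; lra.
Qed.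

(** An off-diagonal product of normals is negative when the angle opposite to the edge is acute,
    which holds for all the center-inner and inner-outer edges; the integer data show it for all
    [e > 0]. *)
Lemma stiffness_hexagon : exists p0 p1 s2 s3 b,
  [/\ hex_matrix (stiffness (hexagon d)) p0 p1 s2 s3 b, 0 < p0, p1 < 0 & b < 0].
Proof.
pose T := stiffness_table (hexagon d).
pose c := center_tri 0; pose m := middle_tri 0; pose o := outer_tri 0.
exists (6 * T c 0%N 0%N), (2 * T c 0%N 1%N),
  (2 * T c 1%N 1%N + 2 * T m 0%N 0%N + T o 2%N 2%N), (T c 1%N 2%N + T m 0%N 2%N),
  (T m 1%N 0%N + T o 0%N 2%N); split; last 3 first.
- by rewrite mulr_gt0// stiffness_table_gt0//; vm_compute.
- by rewrite pmulr_rlt0// stiffness_table_lt0//; vm_compute.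
- have : T m 1%N 0%N < 0 by apply: stiffness_table_lt0; vm_compute.
  have : T o 0%N 2%N < 0 by apply: stiffness_table_lt0; vm_compute.
  by lra.
move=> U U0.
(* Rotations are handled by the families; [E] supplies the reflection symmetry inside a single
   triangle. *)
have E t a b t' a' b' : hex_area t = hex_area t' -> hex_dot t a b = hex_dot t' a' b' ->
    T t a b = T t' a' b'.
  by rewrite /T !stiffness_table_hexagon => -> ->.
have := @hex_rows R T _ _ _ _ _ _ _ _ _ U _ _ _ U0.
move=> /(_ (T c 0%N 0%N) (T c 0%N 1%N) (T c 1%N 1%N) (T c 1%N 2%N)
  (T m 0%N 0%N) (T m 0%N 2%N) (T m 1%N 0%N) (T o 2%N 2%N) (T o 0%N 2%N)).
case.
- move=> j j6; rewrite /T !(stiffness_table_family Cf j6)//.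
  by split=> //; split; apply: E; vm_compute.
- move=> j j6; rewrite /T !(stiffness_table_family Mf j6)//.
  by split; split; apply: E; vm_compute.
- move=> j j6; rewrite /T !(stiffness_table_family Of j6)//.
  by split; apply: E; vm_compute.
have SE i : \sum_v stiffness (hexagon d) i v * U v =
    \sum_(t <- triangulation) \sum_v table_form (T t) t i v * U v.
  rewrite (sum_assembled (stiffnessE vx)); apply: eq_bigr => t _.
  by apply: eq_bigr => v _; rewrite local_stiffness_table.
move=> r1 r2 r3; split.
- by rewrite SE r1.
- by move=> j j6; rewrite SE r2// .
- by move=> k k6; rewrite SE r3.
Qed.

Lemma mass_hexagon : exists p0 p1 s2 s3 b,
  [/\ hex_matrix (mass (hexagon d)) p0 p1 s2 s3 b, 0 < p0, 0 < p1, 0 < b & 0 < s2 - 2 * s3].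
Proof.
pose T := mass_table (hexagon d).
pose c := center_tri 0; pose m := middle_tri 0; pose o := outer_tri 0.
have kd0 := (kappa_diagP R).2; have ko0 := (kappa_offP R).2.
have kdo := kappa_off_lt_diag R.
have [Dc Dm Do] : [/\ 0 < tarea (hexagon d) c, 0 < tarea (hexagon d) m & 0 < tarea (hexagon d) o].
  by split; apply: vx.1; vm_compute.
exists (6 * T c 0%N 0%N), (2 * T c 0%N 1%N),
  (2 * T c 1%N 1%N + 2 * T m 0%N 0%N + T o 2%N 2%N), (T c 1%N 2%N + T m 0%N 2%N),
  (T m 1%N 0%N + T o 0%N 2%N); split; last 4 first.
- by rewrite /T /mass_table/= !mulr_gt0.
- by rewrite /T /mass_table/= !mulr_gt0.
- by rewrite /T /mass_table/= addr_gt0// mulr_gt0.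
(* With [D] for [tarea] on each orbit, the difference is [2 (Dc + Dm) (kappa_diag - kappa_off) + Do
   kappa_diag]. *)
- rewrite /T /mass_table/=.
  have k0 : 0 < kappa_diag R - kappa_off R by rewrite subr_gt0.
  have := mulr_gt0 Dc k0; have := mulr_gt0 Dm k0; have := mulr_gt0 Do kd0.
  by lra.
move=> U U0.
have := @hex_rows R T _ _ _ _ _ _ _ _ _ U _ _ _ U0.
move=> /(_ (T c 0%N 0%N) (T c 0%N 1%N) (T c 1%N 1%N) (T c 1%N 2%N)
  (T m 0%N 0%N) (T m 0%N 2%N) (T m 1%N 0%N) (T o 2%N 2%N) (T o 0%N 2%N)).
case.
- by move=> j j6; rewrite /T /mass_table !(tarea_family Cf j6)//=; split.
- by move=> j j6; rewrite /T /mass_table !(tarea_family Mf j6)//=; split.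
- by move=> j j6; rewrite /T /mass_table !(tarea_family Of j6)//=; split.
have SE i : \sum_v mass (hexagon d) i v * U v =
    \sum_(t <- triangulation) \sum_v table_form (T t) t i v * U v.
  rewrite (sum_assembled (massE vx)); apply: eq_big_seq => t tT.
  by apply: eq_bigr => v _; rewrite local_mass_table// triangulation_uniq.
move=> r1 r2 r3; split.
- by rewrite SE r1.
- by move=> j j6; rewrite SE r2.
- by move=> k k6; rewrite SE r3.
Qed.

End AtHexagon.

(** * Positivity of the quadratic forms and the kernel at the regular mesh *)

Section QuadraticForms.
Variables (x : node -> R * R) (vx : valid_mesh x).

(** On each triangle the form is a positive multiple of the squared length of the sum of the [U i]
    times the normals, which is the Dirichlet energy. *)
Lemma stiffness_ge0 (U : node -> R) :
  0 <= \sum_i U i * \sum_j stiffness x i j * U j.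
Proof.
have -> : \sum_i U i * \sum_j stiffness x i j * U j = \sum_(t <- triangulation)
    kappa_area R / tarea x t *
    dot (\sum_i (normal_at x t i).1 * U i, \sum_i (normal_at x t i).2 * U i)
     (\sum_i (normal_at x t i).1 * U i, \sum_i (normal_at x t i).2 * U i).
  under eq_bigr => i _ do rewrite (sum_assembled (stiffnessE vx)) mulr_sumr.
  rewrite exchange_big; apply: eq_bigr => t _.
  set A := \sum_i _ * U i; set B := \sum_i (normal_at x t i).2 * U i.
  pose k := kappa_area R / tarea x t.
  transitivity (\sum_i (k * A * ((normal_at x t i).1 * U i) + k * B * ((normal_at x t i).2 * U i))).
    apply: eq_bigr => i _.
    have -> : \sum_v local_stiffness x t i v * U v =
        k * ((normal_at x t i).1 * A + (normal_at x t i).2 * B).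
      rewrite /A /B 2!mulr_sumr -big_split mulr_sumr; apply: eq_bigr => v _ /=.
      by rewrite /local_stiffness /dot /k; ring.
    by ring.
  by rewrite big_split -!mulr_sumr -/A -/B /dot/= /k; ring.
rewrite big_seq; apply: sumr_ge0 => t tT; rewrite mulr_ge0//.
  by rewrite divr_ge0// ltW//; [exact: (kappa_areaP R).2|exact: vx.1].
by rewrite /dot -!expr2 addr_ge0// sqr_ge0.
Qed.

(** On a triangle the form is [tarea] times [kappa_diag - kappa_off] times the sum of the squares
    plus [kappa_off] times the square of the sum; every node belongs to some triangle. *)
Lemma mass_gt0 (U : node -> R) : (exists i, U i != 0) ->
  0 < \sum_i U i * \sum_j mass x i j * U j.
Proof.
move=> [k Uk]; have kd0 := (kappa_diagP R).2; have ko0 := (kappa_offP R).2.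
have k0 : 0 < kappa_diag R - kappa_off R by rewrite subr_gt0 kappa_off_lt_diag.
pose q t := (kappa_diag R - kappa_off R) *
  (U t.1.1 ^+ 2 + U t.1.2 ^+ 2 + U t.2 ^+ 2) + kappa_off R * (U t.1.1 + U t.1.2 + U t.2) ^+ 2.
have q0 t : 0 <= q t.
  apply: addr_ge0; apply: mulr_ge0; [exact: ltW| |exact: ltW|exact: sqr_ge0].
  by rewrite !addr_ge0 ?sqr_ge0.
have -> : \sum_i U i * \sum_j mass x i j * U j = \sum_(t <- triangulation) tarea x t * q t.
  under eq_bigr => i _ do rewrite (sum_assembled (massE vx)) mulr_sumr.
  rewrite exchange_big; apply: eq_big_seq => t tT.
  have ut := triangulation_uniq tT.
  under eq_bigr => i _.
    under eq_bigr => j _ do rewrite local_mass_table//.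
    rewrite sum_table_form// mulrC.
    over.
  by rewrite sum_vertexwise// /mass_table/= /q; ring.
have [t tT kt] := triangulation_cover k.
have h0 u : u \in triangulation -> 0 <= tarea x u * q u.
  by move=> uT; rewrite mulr_ge0// ltW// vx.1.
rewrite (big_rem t tT) ltr_pwDl//; last first.
  by rewrite big_seq; apply: sumr_ge0 => u uT; exact/h0/(mem_rem uT).
apply: mulr_gt0; first exact: vx.1.
apply: ltr_pwDl; last by apply: mulr_ge0; [exact: ltW|exact: sqr_ge0].
apply: mulr_gt0 => //.
have U2 : 0 < U k ^+ 2 by rewrite lt_def sqr_ge0 expf_neq0.
have := sqr_ge0 (U t.1.1); have := sqr_ge0 (U t.1.2); have := sqr_ge0 (U t.2).
by move: kt; rewrite !inE => /or3P[]/eqP kE; rewrite kE in U2; lra.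
Qed.

End QuadraticForms.

Lemma hex_kernel (K M : node -> node -> R) (p0 p1 s2 s3 b q0 q1 r2 r3 c mu nu : R) (U : node -> R) :
  hex_matrix K p0 p1 s2 s3 b -> hex_matrix M q0 q1 r2 r3 c ->
  0 < p0 -> p1 < 0 -> b < 0 -> 0 < q0 -> 0 < q1 -> 0 < c -> 0 < r2 - 2 * r3 ->
  (forall V : node -> R, 0 <= \sum_i V i * \sum_j K i j * V j) ->
  (forall V : node -> R, (exists i, V i != 0) -> 0 < \sum_i V i * \sum_j M i j * V j) ->
  (mu != 0) || (nu != 0) -> (exists i, U i != 0) -> (forall k, U (outer k) = 0) ->
  (forall i, mu * \sum_v K i v * U v = nu * \sum_v M i v * U v) ->
  [/\ mu != 0, mu * (s2 - 2 * s3) = nu * (r2 - 2 * r3), U Defs.center = 0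
    & forall j, (j < 6)%N -> U (inner j) = (-1) ^+ j * U (inner 0)].
Proof.
move=> hK hM p0_gt0 p1_lt0 b0 q0_gt0 q1_gt0 c0 r0 psd pd munu Un0 U0 H.
have [K1 K2 K3] := hK U U0; have [M1 M2 M3] := hM U U0.
(* mu b = nu c would force mu nu < 0, against the positivity of the forms. *)
have beta : mu * b - nu * c != 0.
  apply/negP; rewrite subr_eq0 => /eqP e.
  have E : mu * \sum_i U i * \sum_j K i j * U j = nu * \sum_i U i * \sum_j M i j * U j.
    by rewrite 2!mulr_sumr; apply: eq_bigr => i _; rewrite mulrCA H mulrCA.
  have P := psd U; have Q := pd U Un0.
  have [m0|m0] := eqVneq mu 0.
    move: munu; rewrite m0 eqxx/= => n0; move: e; rewrite m0 mul0r => /esym/eqP.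
    by rewrite mulf_eq0 (negbTE n0) (gt_eqF c0).
  have mu2 : 0 < mu * mu by rewrite -expr2 lt_def sqr_ge0 expf_neq0.
  have mn : mu * nu < 0.
    have : mu * nu * c < 0 by rewrite -mulrA -e mulrA pmulr_rlt0.
    by rewrite pmulr_llt0.
  have : mu * mu * \sum_i U i * \sum_j K i j * U j < 0.
    by rewrite -mulrA E mulrA nmulr_rlt0.
  by rewrite ltNge mulr_ge0// ltW.
have alt k : (k < 6)%N -> U (inner (k + 5)) + U (inner k) = 0.
  move=> k6; have := H (outer k); rewrite K3// M3// => e.
  apply/eqP; have : (mu * b - nu * c) * (U (inner (k + 5)) + U (inner k)) = 0.
    by rewrite mulrBl -!mulrA e subrr.
  by move=> /eqP; rewrite mulf_eq0 (negbTE beta).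
have a0 := alt 0%N isT; have a1 := alt 1%N isT; have a2 := alt 2%N isT.
have a3 := alt 3%N isT; have a4 := alt 4%N isT; have a5 := alt 5%N isT.
rewrite /= in a0 a1 a2 a3 a4 a5.
have e6 := inner_periodic 0; have e7 := inner_periodic 1.
have e8 := inner_periodic 2; have e9 := inner_periodic 3; have e10 := inner_periodic 4.
rewrite /= in e6 e7 e8 e9 e10.
rewrite ?add0n ?addSn in a0 a1 a2 a3 a4 a5 e6 e7 e8 e9 e10.
rewrite e6 in a1; rewrite e7 in a2; rewrite e8 in a3; rewrite e9 in a4; rewrite e10 in a5.
have altj j : (j < 6)%N -> U (inner j) = (-1) ^+ j * U (inner 0).
  by case: j => [|[|[|[|[|[|//]]]]]] _; rewrite ?expr0 ?expr1 ?exprS ?expr0; lra.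
have r0' := H (inner 0); rewrite K2// M2// in r0'.
have r1' := H (inner 1); rewrite K2// M2// in r1'.
have rc := H Defs.center; rewrite K1 M1 in rc.
have S0 : \sum_(0 <= j < 6) U (inner j) = 0 by rewrite unlock /=; lra.
rewrite S0 !mulr0 !addr0 in rc.
rewrite ?add0n ?addSn ?e6 in r0' r1'.
set Uc := U Defs.center in r0' r1' rc *.
have u1 : U (inner 1) = - U (inner 0) by lra.
have u2 : U (inner 2) = U (inner 0) by lra.
have u5 : U (inner 5) = - U (inner 0) by lra.
rewrite u1 u5 in r0'; rewrite u1 u2 in r1'.
(* Adding the rows of two adjacent inner nodes cancels the alternating part and leaves the coupling
   to the center. *)
have cc : mu * (p1 * Uc) = nu * (q1 * Uc) by lra.
have Uc0 : Uc = 0.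
  apply/eqP/negPn/negP => Ucn.
  have A : mu * p0 = nu * q0 by apply: (mulIf Ucn); rewrite -!mulrA.
  have B : mu * p1 = nu * q1 by apply: (mulIf Ucn); rewrite -!mulrA.
  (* A nonzero center value would make [(p0, p1)] and [(q0, q1)] satisfy the same relation, but
     [p0 * q1 > 0 > p1 * q0]. *)
  have m0 : mu = 0.
    have : mu * (p0 * q1 - p1 * q0) = 0.
      by rewrite mulrBr !mulrA A B; ring.
    move/eqP; rewrite mulf_eq0 => /orP[/eqP//|].
    by rewrite gt_eqF// subr_gt0 (@lt_trans _ _ 0)// ?mulr_gt0// nmulr_rlt0.
  move: A munu; rewrite m0 mul0r eqxx/= => /esym/eqP.
  by rewrite mulf_eq0 (gt_eqF q0_gt0) orbF => ->.
have un : U (inner 0) != 0.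
  apply/negP => /eqP u0; have [i] := Un0; apply/negP; rewrite negbK; apply/eqP.
  rewrite -(fintype.splitK i); case: (fintype.split i) => [i'|k] /=.
    case: (unliftP ord0 i') => [j|] ->; last exact: Uc0.
    have -> : lshift 6 (lift ord0 j) = inner j.
      by rewrite /inner /cyc6; congr (lshift _ (lift _ _)); apply: val_inj; rewrite /= modn_small.
    by rewrite altj// u0 mulr0.
  rewrite -(U0 k); congr U; rewrite /outer /cyc6; congr (rshift _ _).
  by apply: val_inj; rewrite /= modn_small.
have eqn : mu * (s2 - 2 * s3) = nu * (r2 - 2 * r3).
  by apply: (mulIf un); rewrite Uc0 in r0'; lra.
split=> //; apply: contraTneq munu => m0; rewrite m0 eqxx/= negbK.
by move: eqn; rewrite m0 mul0r => /esym/eqP; rewrite mulf_eq0 (gt_eqF r0) orbF.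
Qed.

End HexagonMatrices.

(** * The perturbed kernel *)

Section InteriorVectors.
Variable R : realType.
Implicit Types (u : 'cV[R]_7) (S : 'M[R]_(7 + 6)).

Definition extend0 u (i : node) : R := (col_mx u (0 : 'cV_6)) i 0.

Lemma outerE (k : 'I_6) : rshift 7 k = outer k.
Proof.
by rewrite /outer /cyc6; congr (rshift _ _); apply: val_inj; rewrite /= modn_small.
Qed.

Lemma innerE (j : 'I_6) : lshift 6 (lift ord0 j) = inner j.
Proof.
rewrite /inner /cyc6; congr (lshift _ (lift _ _)).
by apply: val_inj; rewrite /= modn_small.
Qed.

Lemma extend0_outer u k : extend0 u (outer k) = 0.
Proof. by rewrite /extend0 /outer col_mxEd mxE. Qed.

Lemma sum_extend0 S u i : \sum_v S i v * extend0 u v = (lsubmx S *m u) i 0.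
Proof.
rewrite big_split_ord/= [X in _ + X]big1 ?addr0 => [|k _].
  rewrite mxE; apply: eq_bigr => j _.
  by rewrite /extend0 col_mxEu mxE.
by rewrite outerE extend0_outer mulr0.
Qed.

Lemma alternating_orthogonal S p0 p1 s2 s3 b u : hex_matrix S p0 p1 s2 s3 b ->
  (u_B R)^T *m (dlsubmx S *m u) = 0.
Proof.
move=> hS; have [_ _ h] := hS (extend0 u) (extend0_outer u).
apply/matrixP => i j; rewrite !ord1 [RHS]mxE mxE.
have E (k : 'I_6) : (u_B R)^T 0 k * (dlsubmx S *m u) k 0 =
    (-1) ^+ k * (b * (extend0 u (inner (k + 5)) + extend0 u (inner k))).
  rewrite -h// -outerE sum_extend0 !mxE; congr (_ * _).
  by apply: eq_bigr => v _; rewrite !mxE.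
under eq_bigr => k _ do rewrite E.
rewrite -(big_mkord xpredT (fun k => (-1) ^+ k *
  (b * (extend0 u (inner (k + 5)) + extend0 u (inner k))))).
have e6 := inner_periodic 0; have e7 := inner_periodic 1.
have e8 := inner_periodic 2; have e9 := inner_periodic 3; have e10 := inner_periodic 4.
rewrite /= in e6 e7 e8 e9 e10.
rewrite unlock /= ?addSn ?add0n e6 e7 e8 e9 e10 !exprS expr0.
by ring.
Qed.

(** Testing on unit vectors identifies the entries that occur in [lambda_star]. *)
Lemma hex_matrix_entries S p0 p1 s2 s3 b : hex_matrix S p0 p1 s2 s3 b ->
  S (inner 0) (inner 0) = s2 /\ S (inner 0) (inner 1) = s3.
Proof.
move=> hS.
have delta k : \sum_v S (inner 0) v * (v == k)%:R = S (inner 0) k.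
  by rewrite -[RHS](sum_delta k); apply: eq_bigr => v _; rewrite mulrC.
split.
- have [|_ /(_ 0%N isT)+ _] := hS (fun v => (v == inner 0)%:R); first by [].
  by rewrite delta => ->; decide_node_eqs; rewrite /= !mulr0 !addr0 add0r mulr0 mulr1 addr0.
- have [|_ /(_ 0%N isT)+ _] := hS (fun v => (v == inner 1)%:R); first by [].
  by rewrite delta => ->; decide_node_eqs; rewrite /= !mulr0 !add0r mulr1.
Qed.

End InteriorVectors.

(** * Injectivity of the limit pencil *)

Section LimitPencil.
Variables (R : realType) (d : R) (d_gt : 2 / Num.sqrt 3 < d).
Variables dA dM : 'M[R]_(7 + 6).
Hypothesis transversal : inner_product
  ((dlsubmx dA - lambda_star d *: dlsubmx dM) *m u_I R) (u_B R) != 0.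

Local Notation K := (stiffness (hexagon d)).
Local Notation M := (mass (hexagon d)).

(** [lsubmx] stacks the blocks II and BI, so the pencil has 13 + 1 rows for 7 unknowns. *)
Let P0 := col_mx (lsubmx K) ((u_B R)^T *m dlsubmx dA).
Let Q0 := col_mx (lsubmx M) ((u_B R)^T *m dlsubmx dM).

Lemma limit_pencil_injective (mu nu : R) (u : 'cV_7) :
  (mu != 0) || (nu != 0) -> mu *: (P0 *m u) = nu *: (Q0 *m u) -> u = 0.
Proof.
move=> munu; rewrite !mul_col_mx !scale_col_mx => /eq_col_mx[E1 E2].
have vx := valid_hexagon d_gt.
have [p0 [p1 [s2 [s3 [b [hK p0_gt0 p1_lt0 b_lt0]]]]]] := stiffness_hexagon d_gt.
have [q0 [q1 [r2 [r3 [c [hM q0_gt0 q1_gt0 c_gt0 r_gt0]]]]]] := mass_hexagon d_gt.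
apply: contrapT => /eqP u0; pose U := extend0 u.
have Un0 : exists i, U i != 0.
  apply: contrapT => H; move/eqP: u0; apply; apply/matrixP => i j.
  rewrite (ord1 j) mxE; apply/eqP/negPn/negP => ui; apply: H; exists (lshift 6 i).
  by rewrite /U /extend0 col_mxEu.
have H i : mu * \sum_v K i v * U v = nu * \sum_v M i v * U v.
  rewrite !sum_extend0; have /matrixP/(_ i 0) := E1.
  by rewrite !mxE.
have [mu0 ratio Uc Ualt] := hex_kernel hK hM p0_gt0 p1_lt0 b_lt0 q0_gt0 q1_gt0 c_gt0
  r_gt0 (stiffness_ge0 vx) (mass_gt0 vx) munu Un0 (extend0_outer u) H.
pose t := U (inner 0).
have uE : u = t *: u_I R.
  apply/matrixP => i j; rewrite (ord1 j) !mxE.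
  have -> : u i 0 = U (lshift 6 i) by rewrite /U /extend0 col_mxEu.
  case: (unliftP ord0 i) => [k|] ->; last by rewrite mulr0; exact: Uc.
  by rewrite innerE Ualt// mulrC.
have t0 : t != 0.
  by apply: contra u0 => /eqP t0; rewrite uE t0 scale0r.
have nuE : nu = mu * lambda_star d.
  have [k0 k1] := hex_matrix_entries hK; have [m0 m1] := hex_matrix_entries hM.
  by rewrite /lambda_star k0 k1 m0 m1 mulrA ratio mulfK// gt_eqF.
move/negP: transversal; apply; apply/eqP.
have -> : inner_product ((dlsubmx dA - lambda_star d *: dlsubmx dM) *m u_I R) (u_B R) =
   ((u_B R)^T *m ((dlsubmx dA - lambda_star d *: dlsubmx dM) *m u_I R)) 0 0.
  rewrite /inner_product [RHS]mxE; apply: eq_bigr => k _.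
  by rewrite mulrC [in RHS]mxE.
(* For [u = t u_I] and [nu = mu lambda_star], the additional row of the pencil is [mu t] times the
   transversality pairing. *)
apply: (mulfI (mulf_neq0 mu0 t0)); rewrite mulr0.
have /matrixP/(_ 0 0) := E2.
rewrite nuE uE -!mulmxA -!scalemxAr [LHS]mxE [RHS]mxE => e.
rewrite mulmxBl mulmxBr mxE [X in _ + X]mxE -!scalemxAl -!scalemxAr [X in _ - X]mxE mulrBr.
move: e; rewrite [in X in _ * X = _]mxE [in X in _ = _ * X]mxE.
set X := (_ *m (dlsubmx dA *m _)) 0 0; set Y := (_ *m (dlsubmx dM *m _)) 0 0 => e.
by rewrite -mulrA e; ring.
Qed.

End LimitPencil.

Theorem theorem4p4 (R : realType) (d : R) (x : R -> node -> R * R)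
    (d_gt : 2 / Num.sqrt 3 < d)
    (simple_lambda : simple_neumann_eigenvalue (stiffness (hexagon d))
       (mass (hexagon d)) (lambda_star d))
    (x0 : x 0 = hexagon d)
    (x_C1 : forall i : node, C1_near (fun s => x s i) 0)
    (transversal :
       let dA := mxderiv (fun s => stiffness (x s)) 0 in
       let dM := mxderiv (fun s => mass (x s)) 0 in
       inner_product
         ((dlsubmx dA - lambda_star d *: dlsubmx dM) *m u_I R) (u_B R) != 0) :
  exists2 eps : R, 0 < eps &
    forall s : R, 0 < `|s| < eps ->
      unique_continuation (stiffness (x s)) (mass (x s)).
Proof.
have x_derivable i : derivable (x^~ i) 0 1.
  have h : nbhs (0 : R) (fun s => derivable (x^~ i) s 1 /\
    {for s, continuous (derive1 (x^~ i))}) by exact: (x_C1 i).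
  exact: (nbhs_singleton h).1.
have vx0 : valid_mesh (x 0) by rewrite x0; exact: valid_hexagon.
have dK := derivable_stiffness x_derivable vx0.
have dM := derivable_mass x_derivable vx0.
pose K s := stiffness (x s); pose M s := mass (x s).
(* The last row is the difference quotient of the alternating combination of the BI rows. It is
   studied for [s] tending to [0] with [s != 0], so the value of [s^-1] at [0] does not matter. *)
pose P (F : R -> 'M[R]_(7 + 6)) s := col_mx (lsubmx (F s))
  (s^-1 *: ((u_B R)^T *m (dlsubmx (F s) - dlsubmx (F 0)))).
have cvgP (F : R -> 'M[R]_(7 + 6)) : (forall i j, derivable (fun s => F s i j) 0 1) ->
    forall i j, P F s i j @[s --> 0^'] -->
      col_mx (lsubmx (F 0)) ((u_B R)^T *m dlsubmx (mxderiv F 0)) i j.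
  move=> dF i j; rewrite -(fintype.splitK i).
  case: (fintype.split i) => {}i /=.
    under eq_fun do rewrite col_mxEu mxE; rewrite col_mxEu mxE.
    have c : {for (0 : R), continuous (fun s => F s i (lshift 6 j))}.
      exact/differentiable_continuous/derivable1_diffP/dF.
    exact: ((continuous_withinNx _ _).1 c).
  rewrite col_mxEd mxE; under eq_fun do rewrite col_mxEd !mxE mulr_sumr.
  apply: cvg_big => [|k _]; first exact: add_continuous.
  apply: (@cvg_trans _ ((u_B R)^T i k * ((F s (rshift 7 k) (lshift 6 j) -
      F 0 (rshift 7 k) (lshift 6 j)) / s) @[s --> 0^'])).
    apply: near_eq_cvg; near=> s; rewrite ![in RHS]mxE.
    by rewrite [_ / s]mulrC mulrCA !mxE.
  apply: cvgM; first exact: cvg_cst.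
  rewrite !mxE; exact: derivable_cvg_quotient.
have inj := @limit_pencil_injective R d d_gt _ _ transversal.
have near_inj : \forall s \near 0^', forall (l : R) (u : 'cV_7),
    P K s *m u = l *: (P M s *m u) -> u = 0.
  (* The two charts of the projective line are the homogeneous parameters [(1, l)] and [(l, 1)]. *)
  apply: (pencil_injective_near (cvgP K dK) (cvgP M dM)) => l u.
    rewrite /K /M x0 => e; apply: (inj 1 l); first by rewrite oner_eq0.
    by rewrite scale1r.
  rewrite /K /M x0 => e; apply: (inj l 1); first by rewrite oner_eq0 orbT.
  by rewrite scale1r.
move: near_inj => /nbhs_ballP[eps /= eps0 ball_inj].
exists eps => // s /andP[s0 s_eps] l; apply/seteqP; split => [u [/= e1 e2]|u /= ->]; last first.
  by split; rewrite /= mulmx0.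
have {}ball_inj := ball_inj s _ _ l u; apply: ball_inj.
- by rewrite /ball/= sub0r normrN.
- by rewrite /= -normr_gt0.
have [p0 [p1 [s2 [s3 [b [hK _ _ _]]]]]] := stiffness_hexagon d_gt.
have [q0 [q1 [r2 [r3 [c [hM _ _ _ _]]]]]] := mass_hexagon d_gt.
have PE (F : R -> 'M[R]_(7 + 6)) : P F s *m u = col_mx (lsubmx (F s) *m u)
    (s^-1 *: ((u_B R)^T *m (dlsubmx (F s) - dlsubmx (F 0))) *m u).
  exact: mul_col_mx.
rewrite [LHS](PE K) [X in _ = _ *: X](PE M) [RHS]scale_col_mx.
have E1 : ulsubmx (K s) *m u = l *: (ulsubmx (M s) *m u).
  by apply/eqP; rewrite -subr_eq0 scalemxAl -mulmxBl; apply/eqP.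
have E2 : dlsubmx (K s) *m u = l *: (dlsubmx (M s) *m u).
  by apply/eqP; rewrite -subr_eq0 scalemxAl -mulmxBl; apply/eqP.
congr col_mx.
  have lE (A : 'M[R]_(7 + 6)) : lsubmx A = col_mx (ulsubmx A) (dlsubmx A).
    by rewrite -[A in LHS]submxK block_mxEh row_mxKl.
  by rewrite !lE !mul_col_mx scale_col_mx E1 E2.
(* Orthogonality at the regular mesh removes the subtracted term, so the quotient row is a multiple
   of the BI equations at [s] and adds no new constraint for [s != 0]. *)
have lower (A B : 'M[R]_(7 + 6)) : (u_B R)^T *m (dlsubmx B *m u) = 0 ->
    s^-1 *: ((u_B R)^T *m (dlsubmx A - dlsubmx B)) *m u =
    s^-1 *: ((u_B R)^T *m (dlsubmx A *m u)).
  by move=> B0; rewrite -scalemxAl -mulmxA mulmxBl mulmxBr B0 subr0.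
have K0 : (u_B R)^T *m (dlsubmx (K 0) *m u) = 0.
  by rewrite /K x0; exact: alternating_orthogonal hK.
have M0 : (u_B R)^T *m (dlsubmx (M 0) *m u) = 0.
  by rewrite /M x0; exact: alternating_orthogonal hM.
rewrite [LHS](lower (K s) (K 0) K0) E2 -scalemxAr scalerA mulrC -[LHS]scalerA.
by congr (_ *: _); rewrite [RHS](lower (M s) (M 0) M0).
Unshelve. all: by end_near. Qed.
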